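(* Let $G$ be a finite abelian group of odd order $n$ and let $c$ be a $3$-coloring of $G$ with non-empty color classes $A,B,C$. Then $c$ is rainbow-free if and only if there exist an element $g\in G$, a proper subgroup $H<G$ and a labelling of the three color classes of the translated coloring $c'(x)=c(x+g)$ as $A',B',C'$ (in some order) such that: (i) $A'\subseteq H$, and the $3$-coloring induced by $c'$ on $H$ is rainbow-free; (ii) both $\widetilde{B}=B'\setminus H$ and $\widetilde{C}=C'\setminus H$ are $H$-periodic sets; (iii) $\widetilde{B}=-\widetilde{B}=2\cdot\widetilde{B}$ and $\widetilde{C}=-\widetilde{C}=2\cdot\widetilde{C}$.
   Context: A $3$-coloring of a set $X$ is a map $c:X\to\{1,2,3\}$; its color classes are the preimages of the three colors. A $3$-term arithmetic progression in an abelian group $G$ is an ordered triple $(x,y,z)\in G^3$ with $x+y=2z$; it is rainbow if $x,y,z$ receive pairwise distinct colors. A coloring is rainbow-free if there is no rainbow $3$-term arithmetic progression. A subset $S\subseteq G$ is $H$-periodic ($H$ a subgroup) if $S+H=S$. For $X\subseteq G$, $2\cdot X=\{2x:x\in X\}$ and $-X=\{-x:x\in X\}$. *)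

(* Defs.v *)
From HB Require Import structures.
From mathcomp Require Import all_boot all_order all_algebra all_fingroup.

Set Implicit Arguments.
Unset Strict Implicit.
Unset Printing Implicit Defensive.

Import GRing.Theory.
Local Open Scope ring_scope.

Definition color_class (G : finZmodType) (c : G -> 'I_3) (i : 'I_3) : {set G} :=
  [set x | c x == i].

Definition is_3ap (G : zmodType) (x y z : G) : Prop := x + y = z *+ 2.

Definition rainbow (G : Type) (c : G -> 'I_3) (x y z : G) : Prop :=
  [/\ c x <> c y, c y <> c z & c x <> c z].

(* The coloring induced on a subset X has as progressions the triples of
   elements of X, since [is_3ap] is computed in the ambient group. *)
Definition rainbow_free_on (G : finZmodType) (X : {set G}) (c : G -> 'I_3) : Prop :=
  forall x y z : G, x \in X -> y \in X -> z \in X ->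
    is_3ap x y z -> ~ rainbow c x y z.

Definition rainbow_free (G : finZmodType) (c : G -> 'I_3) : Prop :=
  forall x y z : G, is_3ap x y z -> ~ rainbow c x y z.

Definition translate_coloring (G : finZmodType) (c : G -> 'I_3) (g : G) : G -> 'I_3 :=
  fun x => c (x + g).

Definition sumset (G : finZmodType) (S T : {set G}) : {set G} :=
  [set x + y | x in S, y in T].

Definition periodic (G : finZmodType) (H : {group G}) (S : {set G}) : Prop :=
  sumset S H = S.

Definition oppset (G : finZmodType) (S : {set G}) : {set G} := [set - x | x in S].

Definition dblset (G : finZmodType) (S : {set G}) : {set G} := [set x *+ 2 | x in S].

(* Main.v *)
Require Import Defs.
From HB Require Import structures.
From mathcomp Require Import all_boot all_order all_algebra all_fingroup.
From mathcomp Require Import all_solvable zify.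

(** Call a class spanning if it lies in no coset of a proper subgroup.  If the class A lies
    in such a coset, take 0 in A and H generated by A: off H the other classes are stable
    under reflections in points of A, hence under translation by H, negation and doubling.
    So it suffices that a rainbow-free coloring with non-empty classes A, B, C has a
    non-spanning class, which is shown by induction on the order of G.

    In a counterexample take a subgroup K of prime order p and look at its cosets.  On a
    cyclic sequence x, x + d, x + 2d, ... some color takes part in every change of color;
    this dominant color, as a function of d in K, colors the complete graph on K without
    rainbow triangles, so by Gallai's theorem some color never dominates, and by
    Cauchy-Davenport that color occurs at most once on a three-colored coset.  Counting with
    Cauchy-Davenport across cosets excludes three-colored cosets; among two-colored ones, one
    pair of colors, say A and C, never occurs, and A and C meet each coset in at most one
    point.  As midpoints and reflections mixing A and C stay in A and C, the set of all
    differences of points of A and C is a subgroup meeting K trivially, and A is not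
    spanning.  Periodic auxiliary colorings are handled by induction on G / K. *)

Set Implicit Arguments.
Unset Strict Implicit.
Unset Printing Implicit Defensive.

Import GRing.Theory.
Local Open Scope ring_scope.

(** * Linear identities in abelian groups, halving and spanning sets *)

(** Many contradictions come from one principle: a non-empty set stable under reflections in, or
    midpoints with, the points of a spanning set is the whole group. Combining two such maps gives a
    translation by a difference of two of these points, or by twice one, and the differences lie in
    no proper subgroup. Odd order enters through halving: midpoints exist, are unique and stay in
    every subgroup. Prime order of K makes each nonzero step of K a generator, so a subset of K
    stable under one step is empty or full. The main obstacle is to carry information from one coset
    of K to another; this is done by sumset bounds at the coset of the midpoint. Minimality is used
    only for colorings periodic under a nontrivial subgroup, since these live on a smaller quotient.
    Hence the recolorings: they turn an almost periodic coloring into a periodic one that keeps all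
    three colors and has no rainbow progression. *)

Inductive zexp := ZVar of nat | ZZero | ZAdd of zexp & zexp | ZOpp of zexp | ZMuln of zexp & nat.

Section ZmodTactic.
Variable V : zmodType.
Implicit Types (e : zexp) (env : seq V).

Fixpoint zeval env e : V :=
  match e with
  | ZVar i => env`_i
  | ZZero => 0
  | ZAdd e1 e2 => zeval env e1 + zeval env e2
  | ZOpp e1 => - zeval env e1
  | ZMuln e1 n => zeval env e1 *+ n
  end.

(* Coefficients are kept as pairs (positive part, negative part). *)
Fixpoint zcoef e (i : nat) : nat * nat :=
  match e with
  | ZVar j => if j == i then (1, 0)%N else (0, 0)%N
  | ZZero => (0, 0)%N
  | ZAdd e1 e2 => ((zcoef e1 i).1 + (zcoef e2 i).1, (zcoef e1 i).2 + (zcoef e2 i).2)%N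
  | ZOpp e1 => ((zcoef e1 i).2, (zcoef e1 i).1)
  | ZMuln e1 n => ((zcoef e1 i).1 * n, (zcoef e1 i).2 * n)%N
  end.

Lemma zevalE env e : zeval env e =
  \sum_(i < size env) (env`_i *+ (zcoef e i).1 - env`_i *+ (zcoef e i).2).
Proof.
elim: e => [j||e1 IH1 e2 IH2|e IH|e IH n] /=.
- have [lt|le] := ltnP j (size env); last first.
    rewrite nth_default // big1 // => i _.
    case: (j =P i :> nat) => [e|]; last by rewrite !mulr0n subr0.
    by move: (ltn_ord i); rewrite -e ltnNge le.
  rewrite (bigD1 (Ordinal lt)) //= eqxx mulr1n mulr0n subr0 big1 ?addr0 // => i ne.
  case: (j =P i :> nat) => [e|]; last by rewrite !mulr0n subr0.
  by case/eqP: ne; apply: val_inj.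
- by rewrite big1 // => i _; rewrite !mulr0n subr0.
- by rewrite IH1 IH2 -big_split; apply: eq_bigr => i _; rewrite !mulrnDr opprD addrACA.
- by rewrite IH -sumrN; apply: eq_bigr => i _; rewrite opprB.
- by rewrite IH -sumrMnl; apply: eq_bigr => i _; rewrite mulrnBl -!mulrnA.
Qed.

Lemma zmod_eq env e1 e2 :
  all (fun i => (zcoef e1 i).1 + (zcoef e2 i).2 == (zcoef e2 i).1 + (zcoef e1 i).2)%N
      (iota 0 (size env)) ->
  zeval env e1 = zeval env e2.
Proof.
move=> /allP h; rewrite !zevalE; apply: eq_bigr => i _.
have /h/eqP e : val i \in iota 0 (size env) by rewrite mem_iota /= ltn_ord.
apply/eqP; rewrite subr_eq addrAC eq_sym subr_eq -!mulrnDr; apply/eqP; congr (_ *+ _).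
by rewrite e.
Qed.

(** Turns a goal that follows linearly from a hypothesis into an unconditional identity, which
    [zmod] decides. *)
Lemma zmod_eq1 (a b x y : V) : a = b -> x - y = a - b -> x = y.
Proof. by move=> -> /eqP; rewrite subrr subr_eq0 => /eqP. Qed.

Lemma zmod_eq2 (a b a' b' x y : V) :
  a = b -> a' = b' -> x - y = (a - b) + (a' - b') -> x = y.
Proof. by move=> -> -> /eqP; rewrite !subrr addr0 subr_eq0 => /eqP. Qed.

End ZmodTactic.

Ltac zlookup x env :=
  match env with
  | x :: _ => constr:(O)
  | _ :: ?env' => let n := zlookup x env' in constr:(S n)
  end.
(** The match on a dummy term provides backtracking: the second branch is tried when the lookup
    fails. *)
Ltac zinsert x env :=
  match constr:(Set) with
  | _ => let n := zlookup x env in env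
  | _ => constr:(x :: env)
  end.
Ltac zatoms t env :=
  match t with
  | ?a + ?b => let env := zatoms a env in zatoms b env
  | - ?a => zatoms a env
  | ?a *+ _ => zatoms a env
  | 0 => env
  | _ => zinsert t env
  end.
Ltac zreify t env :=
  match t with
  | ?a + ?b => let a := zreify a env in let b := zreify b env in constr:(ZAdd a b)
  | - ?a => let a := zreify a env in constr:(ZOpp a)
  | ?a *+ ?n => let a := zreify a env in constr:(ZMuln a n)
  | 0 => constr:(ZZero)
  | _ => let n := zlookup t env in constr:(ZVar n)
  end.
Ltac zmod :=
  match goal with
  | |- @eq ?V ?l ?r =>
    let env := zatoms l (@nil V) in let env := zatoms r env in
    let e1 := zreify l env in let e2 := zreify r env in
    apply: (@zmod_eq _ env e1 e2); vm_compute; reflexivity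
  end.

Lemma mem_eq (T : finType) (P : {set T}) (x y : T) : x \in P -> x = y -> y \in P.
Proof. by move=> h <-. Qed.

Section Subgroup.
Variables (G : finZmodType) (H : {group G}).
Implicit Types x y : G.

Lemma grp0 : 0 \in H. Proof. exact: group1. Qed.
Lemma grpD x y : x \in H -> y \in H -> x + y \in H. Proof. exact: groupM. Qed.
Lemma grpN x : (- x \in H) = (x \in H). Proof. exact: groupV. Qed.
Lemma grpB x y : x \in H -> y \in H -> x - y \in H.
Proof. by move=> hx hy; apply: grpD; rewrite ?grpN. Qed.
Lemma grpMn x n : x \in H -> x *+ n \in H. Proof. exact: groupX. Qed.
Lemma grpDl x y : x \in H -> (x + y \in H) = (y \in H). Proof. exact: groupMl. Qed.
Lemma grpDr x y : x \in H -> (y + x \in H) = (y \in H). Proof. exact: groupMr. Qed.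
End Subgroup.

(** Multiplication by the inverse of [2] modulo an odd order. Being a multiple of [x], the half
    stays in every subgroup containing [x]. *)
Definition halve (G : finZmodType) (x : G) : G := x *+ #|G|.+1./2.

Section Odd.
Variable (G : finZmodType).
Hypothesis hodd : odd #|G|.
Implicit Types (x y : G) (H : {group G}).

Lemma mulr_card x : x *+ #|G| = 0.
Proof. by rewrite -cardsT; apply: (@expg_cardG _ [set: G]%G); rewrite inE. Qed.

Lemma halveK x : halve x *+ 2 = x.
Proof.
rewrite -mulrnA muln2 -[_.*2]add0n (_ : 0%N = odd #|G|.+1); last by rewrite /= hodd.
by rewrite odd_double_half mulrS mulr_card addr0.
Qed.

Lemma dbl_inj : injective (fun x => x *+ 2).
Proof.
move=> x y /= e; have: halve (x *+ 2) = halve (y *+ 2) by rewrite e.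
by rewrite /halve -!mulrnA mulnC !mulrnA -!/(halve _) !halveK.
Qed.

Lemma dbl_eq0 x : (x *+ 2 == 0) = (x == 0).
Proof. by apply/eqP/eqP => [e|->]; [apply: dbl_inj; rewrite /= e mul0rn | rewrite mul0rn]. Qed.

Lemma dblK x : halve (x *+ 2) = x.
Proof. by apply: dbl_inj; rewrite halveK. Qed.

Lemma halveN x : halve (- x) = - halve x.
Proof. exact: mulNrn. Qed.

Lemma grp_halve H x : (halve x \in H) = (x \in H).
Proof.
apply/idP/idP => h; last exact: grpMn.
by rewrite -(halveK x) grpMn.
Qed.

Lemma grp_dbl H x : (x *+ 2 \in H) = (x \in H).
Proof. by rewrite -{2}(dblK x) grp_halve. Qed.

Lemma halve_inj : injective (@halve G).
Proof. by move=> x y e; rewrite -(halveK x) e halveK. Qed.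

End Odd.

Definition spanning (G : finZmodType) (S : {set G}) : Prop :=
  forall (H : {group G}) (g : G), (forall x, x \in S -> x - g \in H) -> forall x, x \in H.

Section Translation.
Variable (G : finZmodType).
Implicit Types (P S : {set G}).

(** One inclusion suffices: in a finite group a set of translations that contains [0] and is closed
    under addition is a subgroup. *)
Definition tstab P : {set G} := [set t | [forall (x | x \in P), x + t \in P]].

Lemma tstabP P t : reflect (forall x, x \in P -> x + t \in P) (t \in tstab P).
Proof. by rewrite inE; apply: (iffP forall_inP). Qed.

Fact tstab_group_set P : group_set (tstab P).
Proof.
apply/group_setP; split; first by apply/tstabP => x; rewrite FinRing.zmod1gE addr0.
move=> s t /tstabP hs /tstabP ht; apply/tstabP => x /hs /ht.
by rewrite FinRing.zmodMgE addrA.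
Qed.
Canonical tstab_group P := Group (tstab_group_set P).

Hypothesis hodd : odd #|G|.

(** Odd order allows halving inside the stabilizer of [P], so it contains the differences of [S]
    themselves; as [S] spans, it is the whole group. *)
Lemma spanning_translations S P : spanning S -> (exists x, x \in P) -> (exists s, s \in S) ->
  (forall s s' x, s \in S -> s' \in S -> x \in P -> x + (s - s') *+ 2 \in P) -> forall x, x \in P.
Proof.
move=> hS [p hp] [s hs] hP x.
have /hS/(_ (x - p)) : forall y, y \in S -> y - s \in tstab_group P.
  move=> y hy; rewrite -(grp_dbl hodd); apply/tstabP => z; exact: hP.
by move/tstabP/(_ _ hp); rewrite addrC subrK.
Qed.

(** The reflections in [s'] and then in [s] compose to the translation by [(s - s') *+ 2]. *)
Lemma spanning_reflection S P : spanning S -> (exists x, x \in P) -> (exists s, s \in S) ->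
  (forall s x, s \in S -> x \in P -> s *+ 2 - x \in P) -> forall x, x \in P.
Proof.
move=> hS hp hs hP; apply: (spanning_translations hS hp hs) => s s' x h h' hx.
apply: mem_eq (hP s _ h (hP s' _ h' hx)) _; zmod.
Qed.

(** Taking midpoints with a fixed point is injective, hence a bijection of the finite set [P]. The
    midpoint map of [s] followed by the inverse of that of [s'] is the translation by [s - s']. *)
Lemma spanning_midpoint S P : spanning S -> (exists x, x \in P) -> (exists s, s \in S) ->
  (forall s x, s \in S -> x \in P -> halve (s + x) \in P) -> forall x, x \in P.
Proof.
move=> hS hp hs hP; apply: (spanning_translations hS hp hs) => s s' x h h' hx.
have inv t : t \in S -> forall y, halve (t + y) \in P -> y \in P.
  move=> ht y hy.
  have im : [set halve (t + z) | z in P] = P.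
    apply/eqP; rewrite eqEcard card_imset ?leqnn ?andbT; last first.
      by move=> u v /(halve_inj hodd)/addrI.
    by apply/subsetP => _ /imsetP[z hz ->]; apply: hP.
  by move: hy; rewrite -{1}im => /imsetP[z hz /(halve_inj hodd)/addrI ->].
have key y : y \in P -> y + (s - s') \in P.
  move=> hy; apply: (inv s') => //; apply: mem_eq (hP s y h hy) _.
  congr halve; zmod.
by rewrite mulr2n addrA; apply: (key); apply: key.
Qed.

End Translation.

(** * Colorings and quotient groups *)

Definition tri (a b k : 'I_3) := [&& a != b, b != k & a != k].

Lemma triC a b k : tri a b k -> tri b a k.
Proof. by rewrite /tri eq_sym => /and3P[-> -> ->]. Qed.

Lemma triR a b k : tri a b k -> tri b k a.
Proof. by rewrite /tri [k == a]eq_sym [b == a]eq_sym => /and3P[-> -> ->]. Qed.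

Lemma triP a b k (h : tri a b k) (i : 'I_3) : [\/ i = a, i = b | i = k].
Proof.
move: h; rewrite /tri -!val_eqE /=.
case: a b k i => [a ha] [b hb] [k hk] [i hi] /= /and3P[h1 h2 h3].
have [e|[e|e]] : i = a \/ i = b \/ i = k by lia.
- by apply: Or31; apply: val_inj.
- by apply: Or32; apply: val_inj.
- by apply: Or33; apply: val_inj.
Qed.

Lemma tri_neq a b k : tri a b k -> [/\ a <> b, b <> k & a <> k].
Proof. by move=> /and3P[/eqP ? /eqP ? /eqP ?]. Qed.

Lemma tri_exists (a b : 'I_3) : a <> b -> exists k, tri a b k.
Proof.
move=> /eqP ab; have: (#|[set a; b]| < #|'I_3|)%N by rewrite cards2 ab card_ord.
rewrite -[X in (_ < X)%N]cardsT ltn_neqAle => /andP[ne _].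
have [k hk] : exists k, k \notin [set a; b].
  apply/existsP; rewrite -negb_forall; apply: contra ne => /forallP h.
  by apply/eqP; congr #|pred_of_set _|; apply/setP => x; rewrite in_setT h.
by exists k; move: hk; rewrite !inE negb_or /tri ab ![k == _]eq_sym => /andP[-> ->].
Qed.

Lemma tri_complete (a : 'I_3) : exists b k, tri a b k.
Proof.
have [b ab] : exists b, a <> b.
  by case: a => -[|[|]] //= ?; [exists (inord 1)|exists ord0..] => /(congr1 val) /=; rewrite ?inordK.
by have [k t] := tri_exists ab; exists b, k.
Qed.

Section Coloring.
Variables (G : finZmodType) (c : G -> 'I_3).
Hypothesis rf : rainbow_free c.
Implicit Types (x y z : G).

Lemma no_rainbow a b k x y z : tri a b k -> x + y = z *+ 2 ->
  c x = a -> c y = b -> c z = k -> False.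
Proof.
move=> /tri_neq[n1 n2 n3] e ex ey ez; apply: (rf e).
by rewrite /rainbow ex ey ez.
Qed.

Lemma mid_color a b k x y z : tri a b k -> x + y = z *+ 2 ->
  c x = a -> c y = b -> c z = a \/ c z = b.
Proof.
move=> t e hx hy; case: (triP t (c z)) => hz; [by left | by right |].
by case: (no_rainbow t e hx hy hz).
Qed.

Lemma end_color a b k x y z : tri a b k -> x + y = z *+ 2 ->
  c x = a -> c z = b -> c y = a \/ c y = b.
Proof.
move=> t e hx hz; case: (triP t (c y)) => hy; [by left | by right |].
by case: (no_rainbow (triR (triC t)) e hx hy hz).
Qed.

End Coloring.

Section Quotient.
Variables (G : finZmodType) (K : {group G}).

(** An alias of the type of cosets that can carry an additive structure. As G is abelian, K is
    normalized by everything and this is the full quotient G / K. *)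
Definition quo : Type := coset_of K.
HB.instance Definition _ := Finite.copy quo (coset_of K).

Lemma quo_norm (x : G) : x \in 'N(K)%g.
Proof.
have := FinRing.zmod_abelian [set: G] => /sub_abelian_norm/(_ (subsetT K))/subsetP.
by apply; rewrite inE.
Qed.

Definition quo_add (x y : quo) : quo := (x * y)%g.
Definition quo_opp (x : quo) : quo := (x^-1)%g.

Fact quo_addA : associative quo_add. Proof. exact: mulgA. Qed.
Fact quo_addC : commutative quo_add.
Proof.
move=> x y; rewrite /quo_add -[x]coset_reprK -[y]coset_reprK -!morphM ?quo_norm //.
by rewrite FinRing.zmod_mulgC.
Qed.
Fact quo_add0 : left_id (1%g : quo) quo_add. Proof. exact: mul1g. Qed.
Fact quo_addN : left_inverse (1%g : quo) quo_opp quo_add. Proof. exact: mulVg. Qed.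

HB.instance Definition _ := GRing.isZmodule.Build quo quo_addA quo_addC quo_add0 quo_addN.

Definition pi (x : G) : quo := coset K x.

Lemma piD x y : pi (x + y) = pi x + pi y.
Proof. exact: (morphM (coset K) (quo_norm x) (quo_norm y)). Qed.

Lemma piN x : pi (- x) = - pi x.
Proof. exact: (morphV (coset K) (quo_norm x)). Qed.

Lemma pi_surj (X : quo) : exists x, pi x = X.
Proof. by exists (repr X); apply: coset_reprK. Qed.

Lemma pi_eq x y : (pi x == pi y) = (x - y \in K).
Proof.
rewrite -subr_eq0 -piN -piD; apply/eqP/idP => [|h]; last exact: coset_id.
by move/coset_idr; apply; apply: quo_norm.
Qed.

Lemma card_quo : (#|{: quo}| * #|K| = #|G|)%N.
Proof.
have := card_quotient (_ : [set: G]%G \subset 'N(K)%g).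
rewrite (_ : #|_ / _|%g = #|{: quo}|) => [->|].
- by rewrite mulnC -cardsT Lagrange // subsetT.
- by apply/subsetP => x _; apply: quo_norm.
- rewrite -cardsT; congr #|pred_of_set _|; apply/setP => X; rewrite inE.
  have [x <-] := pi_surj X; apply: mem_quotient; exact: in_setT.
Qed.

End Quotient.

Definition class_in_proper_coset (G : finZmodType) (c : G -> 'I_3) : Prop :=
  exists (i : 'I_3) (H : {group G}) (g : G),
    H \proper [set: G] /\ forall x, c x = i -> x - g \in H.

Lemma class_in_proper_coset_periodic (G : finZmodType) (K : {group G}) (c : G -> 'I_3) :
  odd #|G| -> (exists2 t, t \in K & t != 0) ->
  (forall (Q : finZmodType) (d : Q -> 'I_3), odd #|Q| -> (#|Q| < #|G|)%N -> rainbow_free d ->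
     (forall i, exists x, d x = i) -> class_in_proper_coset d) ->
  rainbow_free c -> (forall i, exists x, c x = i) ->
  (forall x t, t \in K -> c (x + t) = c x) -> class_in_proper_coset c.
Proof.
move=> hodd [t tK t0] IH rf hne per.
have cpi x y : pi K x = pi K y -> c x = c y.
  by move/eqP; rewrite pi_eq => h; rewrite -(per y _ h) addrC subrK.
pose d (X : quo K) : 'I_3 := c (repr X).
have dpi x : d (pi K x) = c x by apply: cpi; apply: coset_reprK.
have cK : (1 < #|K|)%N.
  by rewrite cardG_gt1; apply/trivgPn; exists t.
have [||X Y Z e|i|i [H [g [pH hH]]]] := IH _ d.
- by move: hodd; rewrite -(card_quo K) oddM => /andP[].
- rewrite -(card_quo K) -{1}[#|{: quo K}|]muln1 ltn_pmul2l //.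
  by apply/card_gt0P; exists 0.
- have [x ex] := pi_surj X; have [y ey] := pi_surj Y; have [z ez] := pi_surj Z.
  move: e; rewrite /is_3ap -ex -ey -ez -piD mulr2n -piD => /eqP; rewrite pi_eq => hk.
  (* The lifted triple is a progression only modulo [K]; the defect is absorbed by [y], whose color
     does not change under [K]. *)
  rewrite /rainbow !dpi -(per y (z + z - (x + y))); last by rewrite -opprB grpN.
  apply: rf; rewrite /is_3ap; zmod.
- by have [x <-] := hne i; exists (pi K x).
pose H' : {set G} := [set x | pi K x \in H].
have gH' : group_set H'.
  apply/group_setP; split; first by rewrite inE /pi morph1; apply: (grp0 H).
  by move=> x y; rewrite !inE FinRing.zmodMgE piD => hx hy; apply: (grpD hx hy).
have [g' eg] := pi_surj g.
exists i, (Group gH'), g'; split.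
  rewrite properE subsetT /=; apply: contraL pH => /subsetP h.
  rewrite properE subsetT /= negbK; apply/subsetP => X _.
  by have [x <-] := pi_surj X; have := h x (in_setT _); rewrite inE.
by move=> x hx; rewrite inE piD piN eg; apply: hH; rewrite dpi.
Qed.

(** * Rainbow-free colorings of the integers *)

Section IntegerColorings.
Variable f : int -> 'I_3.
Hypothesis frf : forall i j m : int, i + j = m + m -> ~ rainbow f i j m.
Implicit Types (i j m N s t : int).

Lemma int_no_rainbow a b k i j m : tri a b k -> i + j = m + m ->
  f i = a -> f j = b -> f m = k -> False.
Proof. by move=> /tri_neq[n1 n2 n3] e h1 h2 h3; apply: (frf e); rewrite /rainbow h1 h2 h3. Qed.

Lemma int_end a b i j m : i + j = m + m -> f i = a -> f m = b -> a <> b -> f j = a \/ f j = b.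
Proof.
move=> e h1 h2 /tri_exists[k t]; case: (triP t (f j)) => h; [by left|by right|].
by case: (int_no_rainbow (triR (triC t)) e h1 h h2).
Qed.

Lemma int_same a i j m : i + j = m + m -> f i = a -> f j <> a -> f m <> a -> f j = f m.
Proof.
move=> e h1 h2 h3; by have [/h2|] := int_end e h1 erefl (fun q => h3 (esym q)).
Qed.

(** Inside a gap of [a], doubling the distance from either end keeps the color. If the gap ended
    with the third color [k], a further [a] would be forced just before [0], at [-2] or [-1]
    according to the parity of [N]. Progressions starting there, with the doublings from [0], spread
    [b] onto a point already known to be [k]. *)
Lemma gap_at0 a b N : 1 < N -> f 0 = a -> f N = a -> (forall i, 0 < i -> i < N -> f i <> a) ->
  f 1 = b -> f (N - 1) = b.
Proof.
move=> N1 f0 fN gap f1.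
have ab : a <> b by move=> h; apply: (gap 1); [lia | lia | rewrite f1 h].
have [k t] := tri_exists ab; have [_ bk ak] := tri_neq t.
case: (triP t (f (N - 1))) => // fN1; first by case: (gap (N - 1)) => //; lia.
exfalso.
have dl i : 0 < i -> i + i < N -> f (i + i) = f i.
  by move=> h1 h2; apply: (int_same (i := 0) (a := a)) => //; [lia | apply: gap; lia..].
have dr i : 0 < i -> i + i < N -> f (N - i - i) = f (N - i).
  by move=> h1 h2; apply: (int_same (i := N) (a := a)) => //; [lia | apply: gap; lia..].
have not_both i : f i = a \/ f i = b -> f i = k \/ f i = a -> f i = a.
  by move=> [//|->] [/bk|].
have [M [eN|eN]] : exists M, N = M + M \/ N = M + M + 1 by exists (N %/ 2)%Z; lia.
- have M2 : 1 < M.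
    suff : M <> 1 by lia.
    by move=> eM; move: fN1; rewrite (_ : N - 1 = 1) ?f1 //; lia.
  have fM : f (M - 1) = k.
    rewrite -dl; [|lia..]; rewrite (_ : _ + _ = N - 1 - 1); last lia.
    by rewrite dr; [|lia..].
  (* The progression [2, 0, -2] allows only [a] or [b] at [-2], and [N, M - 1, -2] only [a] or
     [k]. *)
  have fm2 : f (-2) = a.
    have f2 : f 2 = b by rewrite -f1 -(dl 1) //; lia.
    apply: not_both.
      have [] := int_end (i := 2) (j := -2) (m := 0) _ f2 f0 (fun q => ab (esym q)); first lia.
        by right.
      by left.
    have [] := int_end (i := N) (j := -2) (m := M - 1) _ fN fM ak; first lia.
      by right.
    by left.
  have all_b (n : nat) : (n.+1%:Z < M) -> f n.+1 = b.
    elim: n => [//|n IH] h; rewrite -IH; last lia.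
    rewrite -[LHS]dl; [|lia..].
    by apply: (int_same (i := -2) (a := a)) => //; [lia | apply: gap; lia..].
  have [n en] : exists n : nat, M - 1 = n.+1 by exists `|M - 2|%N; lia.
  by move: fM; rewrite en all_b; last lia.
- have fM1 : f (M + 1) = b.
    rewrite (_ : M + 1 = N - M); last lia.
    by rewrite -dr; [rewrite (_ : N - M - M = 1) //; lia|lia..].
  have fM : f M = k.
    rewrite -dl; [|lia..]; by rewrite (_ : M + M = N - 1) //; lia.
  have fm1 : f (-1) = a.
    apply: not_both.
      have [] := int_end (i := 1) (j := -1) (m := 0) _ f1 f0 (fun q => ab (esym q)); first lia.
        by right.
      by left.
    have [] := int_end (i := N) (j := -1) (m := M) _ fN fM ak; first lia.
      by right.
    by left.
  have all_b (n : nat) : (0 < n)%N -> (n%:Z < N) -> f n = b.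
    elim/ltn_ind: n => n IH n0 nN; have [e1|n1] := eqVneq n 1%N; first by rewrite e1.
    rewrite -(IH n./2); [|lia..].
    have [on|en] := boolP (odd n).
      by apply: (int_same (i := -1) (a := a)) => //; [lia | apply: gap; lia..].
    by rewrite -[RHS]dl; [congr f; lia|lia..].
  have [n en] : exists n : nat, N - 1 = n by exists `|N - 1|%N; lia.
  by move: fN1; rewrite en all_b; [|lia..].
Qed.

End IntegerColorings.

Lemma gap_ends (f : int -> 'I_3) a b (s t : int) :
  (forall i j m : int, i + j = m + m -> ~ rainbow f i j m) ->
  s + 1 < t -> f s = a -> f t = a -> (forall i, s < i -> i < t -> f i <> a) ->
  f (s + 1) = b -> f (t - 1) = b.
Proof.
move=> frf st fs ft gap f1.
have h := @gap_at0 (fun i => f (s + i)) _ a b (t - s).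
rewrite (_ : t - 1 = s + (t - s - 1)); last lia.
apply: h => //; first by move=> i j m e; apply: frf; lia.
- lia.
- by rewrite addr0.
- by rewrite addrC subrK.
- by move=> i h1 h2; apply: gap; lia.
Qed.

Section PeriodicIntegerColorings.
Variables (f : int -> 'I_3) (n : nat).
Hypothesis frf : forall i j m : int, i + j = m + m -> ~ rainbow f i j m.
Hypotheses (n0 : (0 < n)%N) (fper : forall i : int, f (i + n%:Z) = f i).

Definition adjacent a b := exists i : int, (f i = a /\ f (i + 1) = b) \/ (f i = b /\ f (i + 1) = a).

Lemma int_period i (m : nat) : f (i + (n * m)%N%:Z) = f i.
Proof. by elim: m => [|m IH]; [rewrite muln0 addr0 | rewrite -IH -[RHS]fper; congr f; lia]. Qed.

Lemma int_forward (i j : int) :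
  exists m : nat, f (i + m%:Z) = f j /\ f (i + m%:Z + 1) = f (j + 1).
Proof.
have [m em] : exists m : nat, j + (n * (absz i + absz j))%N%:Z = i + m%:Z.
  exists (absz (j + (n * (absz i + absz j))%N%:Z - i)%R); nia.
exists m; rewrite -em; split; first by rewrite int_period.
by rewrite addrAC int_period.
Qed.

Lemma last_occurrence a (s t : int) : s <= t -> f s = a ->
  exists r, [/\ s <= r, r <= t, f r = a & forall j, r < j -> j <= t -> f j <> a].
Proof.
move=> st fs; pose P (m : nat) := (s + m%:Z <= t) && (f (s + m%:Z) == a).
have exP : exists m, P m by exists 0%N; rewrite /P addr0 st fs eqxx.
have [|m /andP[h1 /eqP h2] hm] := ex_maxnP exP (m := absz (t - s)%R).
  by move=> m /andP[h _]; lia.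
exists (s + m%:Z); split=> //; first lia.
move=> j h3 h4 /eqP fj; have /hm : P (absz (j - s)%R); last lia.
by rewrite /P (_ : s + _ = j) ?fj ?h4 //; lia.
Qed.

(** Consider the first place from [t + 1] on where [a] and [k] are adjacent. The color on its right
    has an earlier occurrence; right after the last one comes [b], because no earlier change between
    [a] and [k] is available. The gap so formed starts with [b] and ends with the other color,
    against [gap_ends]. *)
Lemma not_all_adjacent_from a b k (s t : int) : tri a b k -> s <= t -> f s = a -> f t = b ->
  f (t + 1) = k -> (forall j, s <= j -> j <= t -> f j <> k) -> adjacent a k -> False.
Proof.
move=> tabk st fs ft ft1 hk [i0 hi0]; have [ab bk ak] := tri_neq tabk.
pose P (m : nat) := ((f (t + 1 + m%:Z) == a) && (f (t + 1 + m%:Z + 1) == k)) ||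
  ((f (t + 1 + m%:Z) == k) && (f (t + 1 + m%:Z + 1) == a)).
have exP : exists m, P m.
  have [m [h1 h2]] := int_forward (t + 1) i0; exists m; rewrite /P h1 h2.
  by case: hi0 => -[-> ->]; rewrite !eqxx ?orbT.
case: (ex_minnP exP) => m Pm min.
have noadj j : t + 1 <= j -> j < t + 1 + m%:Z -> f j = a \/ f j = k -> f (j + 1) <> f j ->
    f (j + 1) = b.
  move=> h1 h2 hj ne; have npm : ~~ P (absz (j - (t + 1))%R) by apply/negP => /min; lia.
  move: npm; rewrite /P (_ : t + 1 + _ = j); last lia.
  case: (triP tabk (f (j + 1))) ne => // ->.
    by case: hj => -> //; rewrite !eqxx orbT.
  by case: hj => -> //; rewrite !eqxx.
case/orP: Pm => /andP[/eqP h1 /eqP h2].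
- have [||r [r1 r2 fr rmax]] := @last_occurrence k (t + 1) (t + 1 + m%:Z) => //; first lia.
  have rlt : r < t + 1 + m%:Z.
    by case: (r =P t + 1 + m%:Z) => [e|]; [case: ak; rewrite -h1 -fr e | lia].
  have fr1 : f (r + 1) = b.
    by apply: noadj => //; [right | rewrite fr; apply: rmax; lia].
  have := gap_ends frf _ fr h2 _ fr1; rewrite addrK h1 => h; apply: ab; apply: h; first lia.
  by move=> i i1 i2; apply: rmax; lia.
- have [||r [r1 r2 fr rmax]] := @last_occurrence a s (t + 1 + m%:Z) => //; first lia.
  have rlt : r < t + 1 + m%:Z.
    by case: (r =P t + 1 + m%:Z) => [e|]; [case: ak; rewrite -h1 -fr e | lia].
  have fr1 : f (r + 1) = b.
    have nr1 : f (r + 1) <> a by apply: rmax; lia.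
    have [rt|rt] : r < t \/ t + 1 <= r; last 1 first.
    + by apply: noadj => //; [left | rewrite fr].
    + by case: (r =P t) => [e|]; [case: ab; rewrite -fr -ft e | lia].
    have nk : f (r + 1) <> k by apply: hk; lia.
    by case: (triP tabk (f (r + 1))).
  have := gap_ends frf _ fr h2 _ fr1; rewrite addrK h1 => h; apply: bk; apply/esym/h; first lia.
  by move=> i i1 i2; apply: rmax; lia.
Qed.

(** Start at a change between [a] and [b] and walk right to the first [k]. The color just before it
    is [a] or [b], and both cases are instances of [not_all_adjacent_from]. *)
Lemma not_all_adjacent a b k : tri a b k ->
  adjacent a b -> adjacent b k -> adjacent a k -> False.
Proof.
move=> tabk [i hi] abk aak; have [ab bk ak] := tri_neq tabk.
have [j fj] : exists j, f j = k by case: abk => j [[_ h]|[h _]]; [exists (j + 1) | exists j].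
have exP : exists m : nat, f (i + 1 + m%:Z + 1) == k.
  have [m [_ h]] := int_forward (i + 1) (j - 1); exists m; by rewrite h subrK fj.
case: (ex_minnP exP) => m /eqP fm min; set t := i + 1 + m%:Z.
have nk l : i <= l -> l <= t -> f l <> k.
  move=> h1 h2 fl.
  have [e|[e|h]] : l = i \/ l = i + 1 \/ i + 1 < l by lia.
  - by case: hi => -[h _]; move: fl; rewrite e h.
  - by case: hi => -[_ h]; move: fl; rewrite e h.
  have := min (absz (l - 1 - (i + 1))%R).
  by rewrite (_ : _ + 1 = l) ?fl ?eqxx => [/(_ isT)|]; lia.
have ex c' : c' = a \/ c' = b -> exists2 s, f s = c' & i <= s /\ s <= t.
  move=> hc; case: hi => -[h1 h2]; case: hc => ->.
  - by exists i => //; lia.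
  - by exists (i + 1) => //; lia.
  - by exists (i + 1) => //; lia.
  - by exists i => //; lia.
case: (triP tabk (f t)) => ft.
- have [s fs [s1 s2]] := ex b (or_intror erefl).
  by apply: (not_all_adjacent_from (triC tabk) s2 fs ft fm) => // l h1 h2; apply: nk; lia.
- have [s fs [s1 s2]] := ex a (or_introl erefl).
  by apply: (not_all_adjacent_from tabk s2 fs ft fm) => // l h1 h2; apply: nk; lia.
- by case: (nk t) => //; lia.
Qed.

End PeriodicIntegerColorings.

(** * Gallai colorings *)

Section Gallai.
Variables (T : finType) (E : T -> T -> 'I_3).
Hypothesis Esym : forall x y, E x y = E y x.

(** Witnesses that the graph of the edges of color [i] is disconnected on [W]. *)
Definition color_cut (W : {set T}) (i : 'I_3) (U : {set T}) :=
  [&& U \proper W, U != set0 & [forall (x | x \in U), forall (y | y \in W :\: U), E x y != i]].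

Lemma color_cutP (W : {set T}) (i : 'I_3) (U : {set T}) : reflect
  [/\ U \proper W, U != set0 & forall x y, x \in U -> y \in W -> y \notin U -> E x y <> i]
  (color_cut W i U).
Proof.
apply: (iffP and3P) => -[h1 h2 h3]; split=> //.
  by move=> x y hx hy hU; have /forall_inP/(_ x hx)/forall_inP/(_ y) := h3; rewrite inE hU => /(_ hy)/eqP.
apply/forall_inP => x hx; apply/forall_inP => y; rewrite inE => /andP[hU hy].
by apply/eqP; apply: h3.
Qed.

(** Remove a vertex [v]; by induction some color [a] is disconnected on the rest [W']. If no color
    is disconnected on [W], then [v] has edges of all colors. With [U] the [a]-component in [W'] of
    a [b]-neighbor [y] of [v], the edges of color [a] from [v] into [U] and out of [U] determine
    enough colors to exhibit an [a]-cut of [W] after all. *)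
Theorem gallai_cut (W : {set T}) : (1 < #|W|)%N ->
  (forall x y z, x \in W -> y \in W -> z \in W -> x != y -> y != z -> x != z ->
     ~~ tri (E x y) (E y z) (E x z)) ->
  exists i U, color_cut W i U.
Proof.
have [n] := ubnP #|W|; elim: n W => // n IH W leWn W1 notri.
have [v vW] : exists v, v \in W by apply/card_gt0P; lia.
have cW : (#|W| = (#|W :\ v|).+1)%N by rewrite (cardsD1 v W) vW.
have [W'1|W'1] := leqP #|W :\ v| 1.
  have [w ew] : exists w, W :\ v = [set w] by apply/cards1P; apply/eqP; lia.
  have [i [j /and3P[hi _ _]]] := tri_complete (E v w).
  exists i, [set v]; apply/color_cutP; split.
  - by rewrite properEcard sub1set vW cards1.
  - by apply/set0Pn; exists v; rewrite inE.
  - move=> x y; rewrite !inE => /eqP-> yW yv.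
    have : y \in W :\ v by rewrite !inE yv.
    by rewrite ew inE => /eqP-> /eqP; rewrite (negbTE hi).
set W' := W :\ v in cW W'1.
have W'W x : x \in W' -> x \in W by rewrite inE => /andP[].
have W'v x : x \in W' -> v != x by rewrite !inE eq_sym => /andP[].
have inW' x : x \in W -> x != v -> x \in W' by rewrite !inE => -> ->.
have [|x y z hx hy hz|a [U0 /color_cutP[U0W' U00 cut0]]] := IH W' _ W'1; first by lia.
  by apply: notri; apply: W'W.
case: (boolP [exists i, exists U, color_cut W i U]) => [/existsP[i /existsP[U h]]|nocut].
  by exists i, U.
exfalso; have {nocut} nocut i U : color_cut W i U -> False.
  by move=> h; case/existsP: nocut; exists i; apply/existsP; exists U.
have third x y z i j : x \in W -> y \in W -> z \in W -> x != y -> y != z -> x != z ->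
    E x y = i -> E x z = j -> i <> j -> E y z <> i -> E y z = j.
  move=> hx hy hz n1 n2 n3 e1 e2 ij n4.
  have := notri _ _ _ hx hy hz n1 n2 n3; rewrite /tri e1 e2.
  have -> : i != j by apply/eqP.
  have -> : i != E y z by apply/eqP => h; case: n4.
  by rewrite andbT /= negbK => /eqP.
have edge j : exists2 y, y \in W' & E v y = j.
  case: (boolP [exists (y | y \in W'), E v y == j]) => [/exists_inP[y hy /eqP h]|].
    by exists y.
  rewrite negb_exists => /forallP h; case: (nocut j [set v]); apply/color_cutP; split.
  - by rewrite properEcard sub1set vW cards1.
  - by apply/set0Pn; exists v; rewrite inE.
  - move=> x y; rewrite !inE => /eqP-> yW yv e.
    by have := h y; rewrite inW' //= e eqxx.
have [b [k tabk]] := tri_complete a.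
have [ab bk ak] := tri_neq tabk.
have [y yW' Ey] := edge b; have [z zW' Ez] := edge k.
pose r x x' := [&& x \in W', x' \in W' & E x x' == a].
have rsym : connect_sym r by apply: sym_connect_sym => x x'; rewrite /r Esym andbCA.
pose U := [set x | connect r y x].
have yU : y \in U by rewrite inE.
have Ucl x x' : r x x' -> (x \in U) = (x' \in U).
  by move=> h; rewrite !inE; apply/idP/idP => h'; apply: connect_trans h' _; [|rewrite rsym]; apply: connect1.
have UW' x : x \in U -> x \in W'.
  rewrite inE => h; have cl : closed r (mem W') by move=> u u' /and3P[-> ->].
  by rewrite -(closed_connect cl h).
have Uout x x' : x \in U -> x' \in W' -> x' \notin U -> E x x' <> a.
  move=> hx hx' nx' e; case/negP: nx'; rewrite -(@Ucl x x') //.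
  by rewrite /r UW' // hx' e eqxx.
(* The [a]-component of [y] stays on one side of the cut [U0]; any point on the other side will
   do. *)
have [w wW' wU] : exists2 w, w \in W' & w \notin U.
  have [yU0|yU0] := boolP (y \in U0).
    have /properP[_ [w wW' wU0]] := U0W'; exists w => //; apply/negP; rewrite inE => h.
    have cl : closed r (mem U0).
      move=> u u' /and3P[h1 h2 /eqP h3]; apply/idP/idP => h4; apply: contraT => h5.
        by case: (cut0 u u').
      by case: (cut0 u' u) => //; rewrite Esym.
    by rewrite -(closed_connect cl h) yU0 in wU0.
  have /set0Pn[w wU0] := U00; have wW' : w \in W' by case/properP: U0W' => /subsetP h _; apply: h.
  exists w => //; apply/negP; rewrite inE => h.
  have cl : closed r (mem U0).
    move=> u u' /and3P[h1 h2 /eqP h3]; apply/idP/idP => h4; apply: contraT => h5.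
      by case: (cut0 u u').
    by case: (cut0 u' u) => //; rewrite Esym.
  by rewrite (closed_connect cl h) wU0 in yU0.
(* Along an [a]-edge of the component the color seen from [x'] cannot change: neither value is [a],
   and two different values would make a rainbow triangle. *)
have unif u x' : u \in U -> x' \in W' -> x' \notin U -> E u x' = E y x'.
  move=> hu hx' nx'.
  have cl : closed r [pred u | (u \in U) && (E u x' == E y x')].
    move=> s t rst; rewrite !inE; have eqU := Ucl _ _ rst; rewrite !inE in eqU; rewrite eqU.
    case: (boolP (connect r y t)) => //= ht.
    have tU : t \in U by rewrite inE.
    have sU : s \in U by rewrite inE eqU.
    have n1 := Uout _ _ sU hx' nx'; have n2 := Uout _ _ tU hx' nx'.
    case/and3P: rst => h1 h2 /eqP h3.
    have [->//|nst] := eqVneq s t.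
    suff -> : E s x' = E t x' by [].
    apply: esym; apply: (third s t x' a) => //; try exact: W'W.
    - by apply: contraNneq nx' => <-.
    - by apply: contraNneq nx' => <-.
    - by move=> h; case: n1.
  have hyu : connect r y u by move: hu; rewrite inE.
  by have := closed_connect cl hyu; rewrite !inE connect0 eqxx => /esym/andP[_ /eqP].
have disj u x' : u \in U -> x' \notin U -> u != x' by move=> hu; apply: contraNneq => <-.
have B_of x' : x' \in W' -> x' \notin U -> E v x' = a -> E y x' = b.
  move=> hx' nx' e; have nb := Uout _ _ yU hx' nx'; rewrite Esym.
  apply: (third v x' y a) => //; try exact: W'W; try exact: W'v.
    by rewrite eq_sym; apply: disj.
  by rewrite Esym.
have [x' [hx' nx' ex']] : exists x', [/\ x' \in W', x' \notin U & E v x' = a].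
  case: (boolP [exists x', [&& x' \in W', x' \notin U & E v x' == a]]).
    by case/existsP => x' /and3P[? ? /eqP ?]; exists x'.
  rewrite negb_exists => /forallP h; case: (nocut a (W' :\: U)); apply/color_cutP; split.
  - apply/properP; split; first by apply/subsetP => s; rewrite inE => /andP[_ /W'W].
    by exists v => //; rewrite !inE eqxx andbF.
  - by apply/set0Pn; exists w; rewrite inE wU.
  - move=> s t; rewrite in_setD => /andP[sU sW'] tW; rewrite in_setD negb_and negbK.
    have [->|tv] := eqVneq t v.
      by move=> _ e; have := h s; rewrite sW' sU Esym e eqxx.
    rewrite inW' // orbF => tU; rewrite Esym; exact: Uout.
have zU : z \notin U.
  apply/negP => zU; have e1 := unif _ _ zU hx' nx'; rewrite B_of // in e1.
  apply: bk; rewrite -e1 Esym; apply: (third v x' z a) => //; try exact: W'W; try exact: W'v.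
    by rewrite eq_sym; apply: disj.
  by rewrite Esym e1 => h; case: ab.
have [x [hx ex]] : exists x, x \in U /\ E v x = a.
  case: (boolP [exists x, (x \in U) && (E v x == a)]).
    by case/existsP => x /andP[? /eqP ?]; exists x.
  rewrite negb_exists => /forallP h; case: (nocut a U); apply/color_cutP; split.
  - apply/properP; split; first by apply/subsetP => s /UW'/W'W.
    by exists v => //; apply/negP => /UW'/W'v; rewrite eqxx.
  - by apply/set0Pn; exists y.
  - move=> s t sU tW tU.
    have [->|tv] := eqVneq t v.
      by move=> e; have := h s; rewrite sU Esym e eqxx.
    by apply: Uout => //; apply: inW'.
have Eyz : E y z = k.
  rewrite -(unif x) //; apply: (third v x z a) => //; try exact: W'W; try exact: W'v.
  - exact/W'W/UW'.
  - exact/W'v/UW'.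
  - exact: disj.
  - exact: Uout.
(* No [a]-edge leaves this set: an [a]-neighbor of [v] outside [U] sees [y] in color [b], edges into
   [U] avoid [a], and for a point seen from [y] in color [b] the triangle through [y] already has
   colors [k] and [b]. *)
case: (nocut a [set t in W' | (t \notin U) && (E y t == k)]); apply/color_cutP; split.
- apply/properP; split; first by apply/subsetP => s; rewrite inE => /andP[/W'W].
  by exists v => //; rewrite !inE eqxx.
- by apply/set0Pn; exists z; rewrite inE zW' zU Eyz eqxx.
move=> s t; rewrite inE => /and3P[sW' sU /eqP es] tW nt.
have [->|tv] := eqVneq t v.
  by rewrite Esym => e; case: bk; rewrite -es B_of.
have tW' := inW' _ tW tv.
have [tU|tU] := boolP (t \in U); first by rewrite Esym; apply: Uout.
move: nt; rewrite inE tW' tU /= => /eqP nt e.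
have nta := Uout _ _ yU tW' tU.
have et : E y t = b by case: (triP tabk (E y t)).
have st : s != t by apply: contra_notN bk => /eqP h; rewrite -es -et h.
have := notri _ _ _ (W'W _ sW') (W'W _ yW') tW.
rewrite [s == y]eq_sym disj // disj // st Esym es et e => /(_ isT isT isT).
by rewrite (triC (triR tabk)).
Qed.

End Gallai.

(** * Subgroups of prime order *)

Section PrimeSubgroup.
Variables (G : finZmodType) (K : {group G}).
Hypothesis Kp : prime #|K|.
Implicit Types (S T P : {set G}) (d x y t : G).

Lemma prime_stable P d x t : d \in K -> d != 0 -> (forall y, y \in P -> y + d \in P) ->
  x \in P -> t \in K -> x + t \in P.
Proof.
move=> dK d0 hP xP tK; suff /subsetP/(_ t tK)/tstabP/(_ x xP) : K \subset [group of tstab P] by [].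
apply: prime_meetG Kp _; apply/trivgPn; exists d => //.
by rewrite inE dK; apply/tstabP.
Qed.

Lemma prime_multiple d x : d \in K -> d != 0 -> x \in K -> exists n, x = d *+ n.
Proof.
move=> dK d0 xK; have /subsetP/(_ x xK)/cycleP[n ->] : K \subset <[d]>%g; last by exists n.
apply: prime_meetG Kp _; apply/trivgPn; exists d => //.
by rewrite inE dK cycle_id.
Qed.

Lemma sumsetP S T z : reflect (exists x y, [/\ x \in S, y \in T & z = x + y]) (z \in sumset S T).
Proof.
apply: (iffP imset2P) => [[x y hx hy ->]|[x [y [hx hy ->]]]]; first by exists x, y.
by exists x y.
Qed.

(** Dyson's transform: if the translate of [T] by some [e = x - y] leaves [S], replace [S] by its
    union with [T + e] and [T] by its part that [e] sends into [S]. The total size is kept, [T]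
    shrinks but retains [y], and the sumset does not grow. Otherwise [S] is stable under a nonzero
    difference of [T], and the sumset is all of [K]. *)
Theorem cauchy_davenport S T : S \subset K -> T \subset K -> S != set0 -> T != set0 ->
  (minn #|K| (#|S| + #|T|).-1 <= #|sumset S T|)%N.
Proof.
have [n] := ubnP #|T|; elim: n S T => // n IH S T leTn SK TK S0 T0.
have /set0Pn[t tT] := T0; have inK := subsetP TK; have inK' := subsetP SK.
have [T1|T1] := leqP #|T| 1.
  rewrite geq_min; apply/orP; right.
  have -> : (#|S| + #|T|).-1 = #|S| by have : (0 < #|T|)%N; [apply/card_gt0P; exists t | lia].
  rewrite -(card_imset (mem S) (addIr t)); apply: subset_leq_card; apply/subsetP => _ /imsetP[x xS ->].
  by apply/sumsetP; exists x, t.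
have [/existsP[x /existsP[y /and4P[xS yT /existsP[u /andP[uT nu]] _]]]|all_per] :=
    boolP [exists x, exists y, [&& x \in S, y \in T,
      [exists u, (u \in T) && (u + (x - y) \notin S)] & true]].
- pose e := x - y.
  pose Te := [set w in T | w + e \in S]; pose Se := S :|: [set w + e | w in T].
  have eK : e \in K by apply: grpB; [apply: inK' | apply: inK].
  have cT : (#|Te| < #|T|)%N.
    apply: proper_card; apply/properP; split; first by apply/subsetP => w; rewrite inE => /andP[].
    by exists u => //; rewrite inE uT (negbTE nu).
  have cST : (#|Se| + #|Te| = #|S| + #|T|)%N.
    have <- : #|S :&: [set w + e | w in T]| = #|Te|.
      rewrite -(card_imset (mem Te) (addIr e)); apply: eq_card => w; rewrite inE.
      apply/andP/imsetP => [[wS /imsetP[v vT ew]]|[v]].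
        by exists v => //; rewrite inE vT -ew.
      by rewrite inE => /andP[vT veS ->]; split=> //; apply/imsetP; exists v.
    by rewrite cardsUI (card_imset (mem T) (addIr e)).
  rewrite -cST; apply: leq_trans (IH Se Te _ _ _ _ _) _.
  + lia.
  + apply/subsetP => w /setUP[/inK'//|/imsetP[v /inK vK ->]]; exact: grpD.
  + by apply/subsetP => w; rewrite inE => /andP[/inK].
  + by case/set0Pn: S0 => s sS; apply/set0Pn; exists s; rewrite inE sS.
  + by apply/set0Pn; exists y; rewrite inE yT addrC subrK.
  apply: subset_leq_card; apply/subsetP => _ /sumsetP[v [w [vSe wTe ->]]].
  move: wTe; rewrite inE => /andP[wT weS]; case/setUP: vSe => [vS|/imsetP[v' v'T ->]].
    by apply/sumsetP; exists v, w.
  apply/sumsetP; exists (w + e), v'; split=> //; zmod.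
- have per x y u : x \in S -> y \in T -> u \in T -> u + (x - y) \in S.
    move=> xS yT uT; apply: contraR all_per => h.
    apply/existsP; exists x; apply/existsP; exists y; rewrite xS yT andbT /=.
    by apply/existsP; exists u; rewrite uT.
  have [u uT ut] : exists2 u, u \in T & u != t.
    have : (0 < #|T :\ t|)%N by move: T1; rewrite (cardsD1 t T) tT.
    by case/card_gt0P => u; rewrite !inE => /andP[h1 h2]; exists u.
  have /set0Pn[s sS] := S0.
  rewrite geq_min; apply/orP; left.
  rewrite -(card_imset (mem K) (addrI (s + t))); apply: subset_leq_card.
  apply/subsetP => _ /imsetP[w wK ->]; apply/sumsetP; exists (s + w), t; split=> //; last by zmod.
  apply: (@prime_stable S (u - t)) => //; first by apply: grpB; apply: inK.
    by rewrite subr_eq0.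
  move=> v vS; apply: mem_eq (per _ _ _ vS tT uT) _; zmod.
Qed.

End PrimeSubgroup.

(** * Dominant colors on a three-colored subgroup of prime order *)

Section PrimeColoring.
Variables (G : finZmodType) (K : {group G}) (c : G -> 'I_3).
Hypotheses (Kp : prime #|K|) (rf : rainbow_free c).
Hypothesis three : forall i, exists2 x, x \in K & c x = i.
Implicit Types (d e x y : G) (a b h k : 'I_3).

Definition dominant h : {set G} := [set d in K | (d != 0) &&
  [forall (x | x \in K), (c x != c (x + d)) ==> (c x == h) || (c (x + d) == h)]].

Lemma dominantP h d : reflect [/\ d \in K, d != 0 &
    forall x, x \in K -> c x <> c (x + d) -> c x = h \/ c (x + d) = h] (d \in dominant h).
Proof.
rewrite inE; apply: (iffP and3P) => -[h1 h2 h3]; split=> //.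
  move=> x hx /eqP ne; have := forall_inP h3 x hx; rewrite ne /= => /orP[]/eqP; by [left|right].
apply/forall_inP => x hx; apply/implyP => /eqP ne.
by apply/orP; case: (h3 x hx ne) => ->; rewrite eqxx; [left|right].
Qed.

(** Pull [c] back along the multiples of [d]. A color that does not dominate leaves a change between
    the two others, so failure of all three colors contradicts [not_all_adjacent]. *)
Lemma dominant_cover d : d \in K -> d != 0 -> exists h, d \in dominant h.
Proof.
move=> dK d0; case: (boolP [exists h, d \in dominant h]) => [/existsP//|].
rewrite negb_exists => /forallP nodom; exfalso.
pose f (i : int) := c (d *~ i).
have frf (i j m : int) : i + j = m + m -> ~ rainbow f i j m.
  by move=> e; apply: rf; rewrite /is_3ap mulr2n -!mulrzDr e.
have fper (i : int) : f (i + #|K|%:Z) = f i.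
  rewrite /f mulrzDr; congr c; rewrite -[RHS]addr0; congr (_ + _).
  by rewrite -pmulrn; apply: (expg_cardG dK).
have adj a b k : tri a b k -> adjacent f a b.
  move=> t; have := nodom k; rewrite inE dK d0 /= => /forall_inPn[x xK].
  rewrite negb_imply negb_or => /and3P[/eqP ne /eqP n1 /eqP n2].
  have [m em] := prime_multiple Kp dK d0 xK.
  exists m%:Z; have e1 : f m%:Z = c x by rewrite /f -pmulrn em.
  have e2 : f (m%:Z + 1) = c (x + d) by rewrite /f mulrzDr mulr1z -pmulrn em.
  rewrite e1 e2.
  case: (triP t (c x)) => h1; case: (triP t (c (x + d))) => h2; rewrite ?h1 ?h2;
    rewrite ?h1 ?h2 in ne n1 n2 => //; by [left|right].
have [b [k t]] := tri_complete ord0.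
apply: (not_all_adjacent frf (prime_gt0 Kp) fper t).
- exact: adj t.
- exact: adj (triR t).
- exact: adj (triR (triC t)).
Qed.

Lemma color_not_stable a d : d \in K -> d != 0 -> exists2 x, x \in K & c x = a /\ c (x + d) <> a.
Proof.
move=> dK d0; case: (boolP [exists (x | x \in K), (c x == a) && (c (x + d) != a)]).
  by case/exists_inP => x hx /andP[/eqP h1 /eqP h2]; exists x.
rewrite negb_exists => /forallP h; exfalso.
have [x xK cx] := three a.
have [b [_ /tri_neq[ab _ _]]] := tri_complete a.
have [y yK cy] := three b.
pose P := [set x in K | c x == a].
have : x + (y - x) \in P.
  apply: (@prime_stable _ K Kp P d) => //; last 2 first.
  - by rewrite inE xK cx eqxx.
  - exact: grpB.
  move=> z; rewrite !inE => /andP[zK cz]; rewrite grpD //=.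
  by have := h z; rewrite zK cz /= negbK.
by rewrite addrC subrK inE cy => /andP[_ /eqP]; apply/nesym.
Qed.

(** The third color also takes part in some change, whose other end can be only one of [h] and
    [h']. *)
Lemma dominant_unique h h' d : d \in dominant h -> d \in dominant h' -> h = h'.
Proof.
move=> /dominantP[dK d0 H1] /dominantP[_ _ H2]; case: (h =P h') => // ne; exfalso.
have [k t] := tri_exists ne; have [n1 n2 n3] := tri_neq t.
have [x xK [cx cxd]] := color_not_stable k dK d0.
have nex : c x <> c (x + d) by rewrite cx => e; case: cxd.
have [e1|e1] := H1 _ xK nex; first by case: n3; rewrite -e1.
have [e2|e2] := H2 _ xK nex; first by case: n2; rewrite -e2.
by case: n1; rewrite -e1.
Qed.

Lemma dominantN h d : (- d \in dominant h) = (d \in dominant h).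
Proof.
suff H d' : d' \in dominant h -> - d' \in dominant h by apply/idP/idP => [/H|/H//]; rewrite opprK.
move=> /dominantP[dK d0 H]; apply/dominantP; split; rewrite ?grpN ?oppr_eq0 // => x xK ne.
have := H (x - d'); rewrite subrK => H'.
by case: (H' (grpB xK dK) (nesym ne)) => ?; [right|left].
Qed.

(** The pattern [a] at [x], [k] at [x + e] occurs and is inherited by [x - d]. It therefore spreads
    over all of [K], leaving no place for [b]. *)
Lemma dominant_no_rainbow a b k d e : tri a b k ->
  d \in dominant b -> e \in dominant k -> d + e \in dominant a -> False.
Proof.
move=> t /dominantP[dK d0 hd] /dominantP[eK e0 he] /dominantP[_ _ hde].
have [ab bk ak] := tri_neq t.
pose P := [set x in K | (c x == a) && (c (x + e) == k)].
have [x xK [cx cxe]] := color_not_stable a eK e0.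
have xP : x \in P.
  rewrite inE xK cx eqxx /=; apply/eqP.
  have := he x xK; rewrite cx => /(_ (nesym cxe))[/ak|] //.
have [y yK cy] := three b.
have : x + (y - x) \in P.
  apply: (@prime_stable _ K Kp P (- d)) => //; rewrite ?grpN ?oppr_eq0 //; last exact: grpB.
  move=> z; rewrite !inE => /and3P[zK /eqP cz /eqP cze].
  have zdK : z - d \in K by apply: grpB.
  have czd : c (z - d) = a.
    case: (triP t (c (z - d))) => // h.
      have := hde _ zdK; rewrite addrA subrK h cze => /(_ bk)[] q; first by case: ab.
      by case: ak.
    have := hd _ zdK; rewrite subrK h cz => /(_ (nesym ak))[] q; first by case: bk.
    by case: ab.
  rewrite zdK czd eqxx /=; apply/eqP.
  case: (triP t (c (z - d + e))) => // h.
    have := hd (z - d + e) (grpD zdK eK); have -> : z - d + e + d = z + e by zmod.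
    rewrite h cze => /(_ ak)[] q; first by case: ab.
    by case: bk.
  have := he _ zdK; rewrite czd h => /(_ ab)[] q; first by case: ak.
  by case: bk.
by rewrite addrC subrK inE cy => /and3P[_ /eqP]; move/esym/ab.
Qed.

(** The color [a] of a Gallai cut dominates no step, since the cut would be stable under that step.
    So the step from a point of color [a] to one of color [h] is dominated by [h], and [dominant b]
    and [dominant k], disjoint and without [0], contain difference sets. With p the order of [K],
    two Cauchy-Davenport bounds give p + |S a| - 2 <= p - 1. *)
Theorem prime_coset_singleton :
  exists a x, [/\ x \in K, c x = a & forall y, y \in K -> c y = a -> y = x].
Proof.
pose D d : 'I_3 := odflt ord0 [pick h | d \in dominant h].
have DP d : d \in K -> d != 0 -> d \in dominant (D d).
  move=> dK d0; rewrite /D; case: pickP => //= none.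
  by have [h hh] := dominant_cover dK d0; have := none h; rewrite hh.
have Dsym x y : D (x - y) = D (y - x).
  by rewrite /D; congr odflt; apply: eq_pick => h; rewrite -dominantN opprB.
have [|x y z xK yK zK xy yz xz|a [U /color_cutP[/properP[UK [w wK wU]] /set0Pn[u uU] cut]]] :=
    @gallai_cut _ (fun x y => D (x - y)) Dsym K.
- exact: prime_gt1.
- apply/negP => t; apply: (@dominant_no_rainbow _ _ _ (x - y) (y - z) (triR (triR t))).
  + by apply: DP; [apply: grpB | rewrite subr_eq0].
  + by apply: DP; [apply: grpB | rewrite subr_eq0].
  + by rewrite addrA subrK; apply: DP; [apply: grpB | rewrite subr_eq0].
have Va d : d \in dominant a -> False.
  move=> hd; have /dominantP[dK d0 _] := hd.
  have uK : u \in K by apply: (subsetP UK).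
  case/negP: wU; have -> : w = u + (w - u) by zmod.
  apply: (@prime_stable _ K Kp U d) => //; last exact: grpB.
  move=> x xU; apply: contraT => nx.
  have xK : x \in K by apply: (subsetP UK).
  case: (cut x (x + d) xU _ nx); first exact: grpD.
  have e : x - (x + d) = - d by zmod.
  rewrite e; apply: (dominant_unique (d := - d)); last by rewrite dominantN.
  by apply: DP; rewrite ?grpN ?oppr_eq0.
have [b [k t]] := tri_complete a; have [ab bk ak] := tri_neq t.
pose S i := [set x in K | c x == i].
have SP i x : (x \in S i) = (x \in K) && (c x == i) by rewrite inE.
have S0 i : S i != set0.
  by have [x xK cx] := three i; apply/set0Pn; exists x; rewrite SP xK cx eqxx.
have SK i : S i \subset K by apply/subsetP => x; rewrite SP => /andP[].
have cN : #|oppset (S a)| = #|S a| by rewrite card_imset //; apply: oppr_inj.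
have sub h : h <> a -> sumset (S h) (oppset (S a)) \subset dominant h.
  move=> ha; apply/subsetP => z /sumsetP[y [y' [yS /imsetP[x xS ->] ->]]].
  move: yS xS; rewrite !SP => /andP[yK /eqP cy] /andP[xK /eqP cx].
  have dK : y - x \in K by apply: grpB.
  have d0 : y - x != 0 by rewrite subr_eq0; apply/eqP => e; case: ha; rewrite -cx -cy e.
  have [h' hh'] := dominant_cover dK d0; have /dominantP[_ _ H] := hh'.
  have := H x xK; rewrite addrC subrK cx cy => /(_ (nesym ha))[e|e]; last by rewrite e.
  by case: (Va (y - x)); rewrite e.
have bound h : h <> a -> (minn #|K| (#|S h| + #|S a|).-1 <= #|dominant h|)%N.
  move=> ha; apply: leq_trans (subset_leq_card (sub h ha)); rewrite -cN.
  apply: cauchy_davenport => //.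
    by apply/subsetP => _ /imsetP[x /(subsetP (SK a)) xK ->]; rewrite grpN.
  by have /set0Pn[x xS] := S0 a; apply/set0Pn; exists (- x); apply: imset_f.
have b1 := bound b (nesym ab); have b2 := bound k (nesym ak).
have cV : (#|dominant b| + #|dominant k| <= #|K|.-1)%N.
  rewrite -cardsUI (_ : _ :&: _ = set0) ?cards0 ?addn0; last first.
    by apply/setP => d; rewrite in_setI in_set0; apply/andP => -[h1 /(dominant_unique h1)].
  rewrite (cardsD1 0 K) grp0 /=; apply: subset_leq_card; apply/subsetP => d.
  by rewrite inE in_setD1 => /orP[] /dominantP[-> ->].
have cS : (#|S a| + #|S b| + #|S k| = #|K|)%N.
  have -> : #|K| = #|S a :|: S b :|: S k|.
    apply: eq_card => x; rewrite !inE -!andb_orr.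
    by case: (triP t (c x)) => ->; rewrite eqxx ?orbT andbT.
  rewrite !cardsU (_ : S a :&: S b = set0); last first.
    apply/setP => x; rewrite !inE; apply/negP => /andP[/andP[_ /eqP h1] /andP[_ /eqP h2]].
    by case: ab; rewrite -h1.
  rewrite (_ : (S a :|: S b) :&: S k = set0) ?cards0 ?subn0 //.
  apply/setP => x; rewrite !inE; apply/negP => /andP[/orP[]/andP[_ /eqP h1] /andP[_ /eqP h2]].
    by case: ak; rewrite -h1.
  by case: bk; rewrite -h1.
have p1 := prime_gt1 Kp.
have sa : (#|S a| <= 1)%N.
  have [x1 x2 x3] : [/\ 0 < #|S a|, 0 < #|S b| & 0 < #|S k|]%N by rewrite !card_gt0 !S0.
  lia.
have [x xK cx] := three a; exists a, x; split=> // y yK cy.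
by have /card_le1_eqP := sa; apply; rewrite SP ?xK ?yK ?cx ?cy eqxx.
Qed.

End PrimeColoring.

(** * Pairs of sets closed under mixed progressions *)

Section MixedClosed.
Variables (G : finZmodType) (K : {group G}).
Hypothesis hodd : odd #|G|.
Hypothesis K1 : exists2 t, t \in K & t != 0.
Implicit Types (A C : {set G}) (x y q : G).

Definition mixed_closed A C := [/\
  forall x y, x \in A -> y \in C -> halve (x + y) \in A :|: C,
  forall x y, x \in A -> y \in C -> x *+ 2 - y \in A :|: C,
  forall x y, x \in A -> y \in C -> y *+ 2 - x \in A :|: C
  & forall q q', q \in A :|: C -> q' \in A :|: C -> q - q' \in K -> q = q'].

Lemma mixed_closedC A C : mixed_closed A C -> mixed_closed C A.
Proof.
move=> [h1 h2 h3 h4]; split; rewrite (setUC C) // => x y hx hy.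
- by rewrite addrC; apply: h1.
- exact: h3.
- exact: h2.
Qed.

(** A progression, and below a parallelogram, that holds modulo [K] but not exactly. *)
Definition bad_triple x1 x x2 := (x1 + x2 - x *+ 2 \in K) && (x1 + x2 - x *+ 2 != 0).
Definition bad_quad x1 x4 x2 x3 := (x1 + x4 - (x2 + x3) \in K) && (x1 + x4 - (x2 + x3) != 0).

(** In a mixed triple, two points from different sets produce by midpoint or reflection an element
    of [A :|: C] in the coset of the third, hence equal to it; then the progression is exact. *)
Lemma bad_triple_mono A C x1 x x2 : mixed_closed A C ->
  x1 \in A :|: C -> x \in A :|: C -> x2 \in A :|: C -> bad_triple x1 x x2 ->
  [&& x1 \in A, x \in A & x2 \in A] || [&& x1 \in C, x \in C & x2 \in C].
Proof.
move=> [hm hA hC one] h1 h h2 /andP[hK /eqP hne].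
have R y : y \in A :|: C -> x2 - y \in K -> x2 = y by move=> hy; apply: one.
have L y : y \in A :|: C -> x1 - y \in K -> x1 = y by move=> hy; apply: one.
have bad1 : x *+ 2 - x1 \in A :|: C -> False.
  move=> /R e; case: hne; rewrite e; first by zmod.
  by apply: mem_eq hK _; zmod.
have bad2 : x *+ 2 - x2 \in A :|: C -> False.
  move=> /L e; case: hne; rewrite e; first by zmod.
  by apply: mem_eq hK _; zmod.
have bad3 : halve (x1 + x2) \in A :|: C -> False.
  move=> hh; have e := one _ _ h hh _; case: hne; rewrite e ?(halveK hodd) ?subrr //.
  rewrite -(grp_dbl hodd) mulrnBl (halveK hodd) -grpN; apply: mem_eq hK _; zmod.
case/setUP: h1 => h1; case/setUP: h => h; case/setUP: h2 => h2; rewrite ?h1 ?h ?h2 ?orbT //; exfalso.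
- by apply: bad3; apply: hm.
- by apply: bad1; apply: hC.
- by apply: bad1; apply: hC.
- by apply: bad1; apply: hA.
- by apply: bad1; apply: hA.
- by apply: bad3; rewrite addrC; apply: hm.
Qed.

(* Reflections in C carry a bad triple of A to a bad triple, which cannot lie in C:
   there x2 + u = x + u1 modulo K would have two distinct midpoints in one coset. *)
Lemma no_bad_triple_in A C x1 x x2 : mixed_closed A C -> spanning C -> C != set0 ->
  x1 \in A -> x \in A -> x2 \in A -> bad_triple x1 x x2 -> False.
Proof.
move=> mc spC /set0Pn C0 h1 h h2 hb.
pose P := [set x in A | [exists x1, exists x2, [&& x1 \in A, x2 \in A & bad_triple x1 x x2]]].
have PP y1 y y2 : y1 \in A -> y \in A -> y2 \in A -> bad_triple y1 y y2 -> y \in P.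
  move=> k1 k k2 hb'; rewrite inE k; apply/existsP; exists y1; apply/existsP; exists y2.
  by rewrite k1 k2.
have all_P z : z \in P.
  apply: (spanning_reflection hodd spC) => //; first by exists x; apply: PP hb.
  move=> y w hy; rewrite inE => /andP[wA /existsP[w1 /existsP[w2 /and3P[w1A w2A hw]]]].
  have [hm hA hC one] := mc; have uQ v : v \in A -> y *+ 2 - v \in A :|: C by move=> hv; apply: hC.
  have hu : bad_triple (y *+ 2 - w1) (y *+ 2 - w) (y *+ 2 - w2).
    case/andP: hw => k1 k2; have e : y *+ 2 - w1 + (y *+ 2 - w2) - (y *+ 2 - w) *+ 2 =
      - (w1 + w2 - w *+ 2) by zmod.
    by rewrite /bad_triple e grpN k1 oppr_eq0.
  have := bad_triple_mono mc (uQ _ w1A) (uQ _ wA) (uQ _ w2A) hu.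
  case/orP => /and3P[k1 k2 k3]; first exact: PP hu.
  exfalso; case/andP: hw => k4 /eqP; apply.
  have e : halve (w2 + (y *+ 2 - w)) = halve (w + (y *+ 2 - w1)).
    apply: one; try exact: hm.
    rewrite -(grp_dbl hodd) mulrnBl !(halveK hodd); apply: mem_eq k4 _; zmod.
  apply: zmod_eq1 (halve_inj hodd e) _; zmod.
(* [A] is now the whole group, so [0] and [t] are two of its points in one coset of [K]. *)
have [t tK /eqP] := K1; apply; have [_ _ _ one] := mc.
have inQ z : z \in A :|: C by have := all_P z; rewrite !inE => /andP[->].
by apply: one; rewrite ?subr0.
Qed.

Lemma mixed_triple A C x1 x x2 : mixed_closed A C -> spanning A -> spanning C ->
  A != set0 -> C != set0 ->
  x1 \in A :|: C -> x \in A :|: C -> x2 \in A :|: C ->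
  x1 + x2 - x *+ 2 \in K -> x1 + x2 = x *+ 2.
Proof.
move=> mc sA sC A0 C0 h1 h h2 hK; apply/eqP; rewrite -subr_eq0; apply: contraT => ne.
have hb : bad_triple x1 x x2 by rewrite /bad_triple hK ne.
have := bad_triple_mono mc h1 h h2 hb.
case/orP => /and3P[k1 k2 k3]; exfalso.
  exact: no_bad_triple_in mc sC C0 k1 k2 k3 hb.
exact: no_bad_triple_in (mixed_closedC mc) sA A0 k1 k2 k3 hb.
Qed.

Lemma bad_quadC x1 x4 x2 x3 : bad_quad x1 x4 x2 x3 -> bad_quad x2 x3 x1 x4.
Proof. by rewrite /bad_quad -opprB grpN oppr_eq0. Qed.

(** A mixed diagonal has its midpoint in [A :|: C]; this point is the midpoint of the other diagonal
    modulo [K], hence exactly by [mixed_triple]. *)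
Lemma bad_quad_mono A C x1 x4 x2 x3 : mixed_closed A C -> spanning A -> spanning C ->
  A != set0 -> C != set0 -> x1 \in A :|: C -> x4 \in A :|: C ->
  x2 \in A :|: C -> x3 \in A :|: C -> bad_quad x1 x4 x2 x3 ->
  (x1 \in A) && (x4 \in A) || (x1 \in C) && (x4 \in C).
Proof.
move=> mc sA sC A0 C0 h1 h4 h2 h3 /andP[hK /eqP hne].
have bad : halve (x1 + x4) \in A :|: C -> False.
  move=> hh; have e : x2 + x3 = halve (x1 + x4) *+ 2.
    apply: (mixed_triple mc) => //; rewrite (halveK hodd) -grpN; apply: mem_eq hK _; zmod.
  by apply: hne; rewrite e (halveK hodd) subrr.
have [hm _ _ _] := mc.
case/setUP: h1 => h1; case/setUP: h4 => h4; rewrite ?h1 ?h4 ?orbT //; exfalso; apply: bad.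
  exact: hm.
by rewrite addrC; apply: hm.
Qed.

Lemma no_bad_quad_in A C x1 x4 x2 x3 : mixed_closed A C -> spanning A -> spanning C ->
  A != set0 -> C != set0 -> x1 \in A -> x4 \in A -> x2 \in A -> x3 \in A ->
  bad_quad x1 x4 x2 x3 -> False.
Proof.
move=> mc sA sC A0 C0 h1 h4 h2 h3 hb.
pose P := [set x1 in A | [exists x4, exists x2, exists x3,
  [&& x4 \in A, x2 \in A, x3 \in A & bad_quad x1 x4 x2 x3]]].
have PP y1 y4 y2 y3 : y1 \in A -> y4 \in A -> y2 \in A -> y3 \in A ->
    bad_quad y1 y4 y2 y3 -> y1 \in P.
  move=> k1 k4 k2 k3 hb'; rewrite inE k1; apply/existsP; exists y4; apply/existsP; exists y2.
  by apply/existsP; exists y3; rewrite k4 k2 k3.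
have all_P z : z \in P.
  apply: (spanning_reflection hodd sC) => [||y w1 hy]; first by exists x1; apply: PP hb.
    exact/set0Pn.
  rewrite inE => /andP[w1A /existsP[w4 /existsP[w2 /existsP[w3 /and4P[w4A w2A w3A hw]]]]].
  have [hm hA hC one] := mc; have uQ v : v \in A -> y *+ 2 - v \in A :|: C by move=> hv; apply: hC.
  have hu v1 v4 v2 v3 : bad_quad v1 v4 v2 v3 ->
      bad_quad (y *+ 2 - v1) (y *+ 2 - v4) (y *+ 2 - v2) (y *+ 2 - v3).
    have e : y *+ 2 - v1 + (y *+ 2 - v4) - (y *+ 2 - v2 + (y *+ 2 - v3)) =
      - (v1 + v4 - (v2 + v3)) by zmod.
    by rewrite /bad_quad e grpN oppr_eq0.
  (* A diagonal of the reflected quadruple lying in C, paired with the other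
     original diagonal, would give a bad triple centred at y. *)
  have notC v1 v4 v2 v3 : v1 \in A -> v4 \in A -> v2 \in A -> v3 \in A -> bad_quad v1 v4 v2 v3 ->
      y *+ 2 - v1 \in A /\ y *+ 2 - v4 \in A.
    move=> k1 k4 k2 k3 hv.
    have := bad_quad_mono mc sA sC A0 C0 (uQ _ k1) (uQ _ k4) (uQ _ k2) (uQ _ k3) (hu _ _ _ _ hv).
    case/orP => /andP[c1 c4]; first by [].
    exfalso; case/andP: hv => hK /eqP; apply.
    have := mixed_triple mc sA sC A0 C0 (hm _ _ k2 c1) (_ : y \in _) (hm _ _ k3 c4).
    rewrite in_setU hy orbT => /(_ isT) H.
    have e2 : (halve (v2 + (y *+ 2 - v1)) + halve (v3 + (y *+ 2 - v4))) *+ 2 - y *+ 2 *+ 2 =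
        - (v1 + v4 - (v2 + v3)) by rewrite mulrnDl !(halveK hodd); zmod.
    have /H e : halve (v2 + (y *+ 2 - v1)) + halve (v3 + (y *+ 2 - v4)) - y *+ 2 \in K.
      by rewrite -(grp_dbl hodd) mulrnBl e2 grpN.
    by apply/eqP; rewrite -oppr_eq0 -e2 e subrr.
  have [u1 u4] := notC _ _ _ _ w1A w4A w2A w3A hw.
  have [u2 u3] := notC _ _ _ _ w2A w3A w1A w4A (bad_quadC hw).
  exact: PP u1 u4 u2 u3 (hu _ _ _ _ hw).
have [t tK /eqP] := K1; apply; have [_ _ _ one] := mc.
have inQ z : z \in A :|: C by have := all_P z; rewrite !inE => /andP[->].
by apply: one; rewrite ?subr0.
Qed.

Lemma mixed_quad A C x1 x4 x2 x3 : mixed_closed A C -> spanning A -> spanning C ->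
  A != set0 -> C != set0 -> x1 \in A :|: C -> x4 \in A :|: C ->
  x2 \in A :|: C -> x3 \in A :|: C -> x1 + x4 - (x2 + x3) \in K -> x1 + x4 = x2 + x3.
Proof.
move=> mc sA sC A0 C0 h1 h4 h2 h3 hK; apply/eqP; rewrite -subr_eq0; apply: contraT => ne.
have hb : bad_quad x1 x4 x2 x3 by rewrite /bad_quad hK ne.
exfalso; move: x1 x4 x2 x3 h1 h4 h2 h3 hb {hK ne}.
have inA y1 y4 y2 y3 : y1 \in A -> y4 \in A -> y2 \in A -> y3 \in A ->
    bad_quad y1 y4 y2 y3 -> False by move=> ? ? ? ?; apply: (no_bad_quad_in mc).
have inC y1 y4 y2 y3 : y1 \in C -> y4 \in C -> y2 \in C -> y3 \in C ->
    bad_quad y1 y4 y2 y3 -> False by move=> ? ? ? ?; apply: (no_bad_quad_in (mixed_closedC mc)).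
(* With one diagonal in each set, the midpoints [p] and [q] of two opposite sides form a bad
   quadruple with either diagonal. Both midpoints lie in [A] or both in [C], so one of these
   quadruples lies in a single set. *)
have cross y1 y4 y2 y3 : y1 \in A -> y4 \in A -> y2 \in C -> y3 \in C ->
    bad_quad y1 y4 y2 y3 -> False.
  move=> k1 k4 k2 k3 /andP[hK ne]; have [hm _ _ _] := mc.
  set p := halve (y1 + y2); set q := halve (y4 + y3).
  have pQ : p \in A :|: C by apply: hm.
  have qQ : q \in A :|: C by apply: hm.
  have e2 : (p + q) *+ 2 = y1 + y2 + (y4 + y3) by rewrite mulrnDl !(halveK hodd).
  have b1 : bad_quad p q y1 y4.
    have e : (p + q - (y1 + y4)) *+ 2 = - (y1 + y4 - (y2 + y3)) by rewrite mulrnBl e2; zmod.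
    rewrite /bad_quad -(grp_dbl hodd) e grpN hK /=.
    by apply: contraNneq ne => e'; rewrite -oppr_eq0 -e e' mul0rn.
  have b2 : bad_quad p q y2 y3.
    have e : (p + q - (y2 + y3)) *+ 2 = y1 + y4 - (y2 + y3) by rewrite mulrnBl e2; zmod.
    rewrite /bad_quad -(grp_dbl hodd) e hK /=.
    by apply: contraNneq ne => e'; rewrite -e e' mul0rn.
  have k1' : y1 \in A :|: C by rewrite inE k1.
  have k4' : y4 \in A :|: C by rewrite inE k4.
  have := bad_quad_mono mc sA sC A0 C0 pQ qQ k1' k4' b1.
  by case/orP => /andP[l1 l2]; [apply: inA b1 | apply: inC b2].
move=> x1 x4 x2 x3 h1 h4 h2 h3 hb.
have := bad_quad_mono mc sA sC A0 C0 h1 h4 h2 h3 hb.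
have := bad_quad_mono mc sA sC A0 C0 h2 h3 h1 h4 (bad_quadC hb).
case/orP => /andP[l1 l2] /orP[]/andP[l3 l4].
- exact: inA hb.
- exact: cross (bad_quadC hb).
- exact: cross hb.
- exact: inC hb.
Qed.

(** Sparsity of the cosets missing [Q] provides an [x] such that [x], [x + g'] and [x + (g + g')]
    all lie in cosets meeting [Q]. By [mixed_quad] their representatives realize [g'] and [g] as
    exact differences, so the differences of [Q] form a group. It contains a translate of [A], hence
    everything, but no nonzero element of [K]. *)
Lemma mixed_dense A C : mixed_closed A C -> spanning A -> spanning C ->
  A != set0 -> C != set0 ->
  (3 * #|[set x | [forall (q | q \in A :|: C), (x - q)%R \notin K]]| < #|G|)%N -> False.
Proof.
move=> mc sA sC A0 C0; set Q := A :|: C; set U := [set x | _] => hU.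
have quad x1 x4 x2 x3 := @mixed_quad A C x1 x4 x2 x3 mc sA sC A0 C0.
pose P := [set z | [exists q, exists q', [&& q \in Q, q' \in Q & z == q - q']]].
have PP z : reflect (exists q q', [/\ q \in Q, q' \in Q & z = q - q']) (z \in P).
  rewrite inE; apply: (iffP existsP) => [[q /existsP[q' /and3P[h h' /eqP e]]]|[q [q' [h h' e]]]].
    by exists q, q'.
  by exists q; apply/existsP; exists q'; rewrite h h' e eqxx.
have [a0 a0A] := set0Pn _ A0; have a0Q : a0 \in Q by rewrite inE a0A.
have gP : group_set P.
  apply/group_setP; split; first by apply/PP; exists a0, a0; rewrite subrr.
  move=> g g' /PP[q1 [q1' [h1 h1' eg]]] /PP[q2 [q2' [h2 h2' eg']]].
  have tr u : #|[set x | x + u \in U]| = #|U|.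
    rewrite -(card_imset (mem [set x | x + u \in U]) (addIr u)); apply: eq_card => x.
    apply/imsetP/idP => [[y]|hx]; first by rewrite inE => hy ->.
    by exists (x - u); [rewrite in_set subrK | rewrite subrK].
  have [x hx] : exists x, x \notin U :|: [set x | x + g' \in U] :|: [set x | x + (g + g') \in U].
    apply/existsP; rewrite -negb_forall; apply/negP => /forallP all.
    have : (#|G| <= 3 * #|U|)%N; last by rewrite leqNgt hU.
    rewrite -cardsT (_ : setT = U :|: [set x | x + g' \in U] :|: [set x | x + (g + g') \in U]).
      have k1 := (leq_card_setU (U :|: [set x | x + g' \in U]) [set x | x + (g + g') \in U]).1.
      have k2 := (leq_card_setU U [set x | x + g' \in U]).1.
      rewrite tr in k1; rewrite tr in k2.
      apply: leq_trans k1 _; apply: leq_trans (leq_add k2 (leqnn _)) _; lia.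
    by apply/setP => x; rewrite in_setT all.
  move: hx; rewrite !in_setU !negb_or => /andP[/andP[x0 x1] x2].
  have row y : y \notin U -> exists2 q, q \in Q & y - q \in K.
    by rewrite inE => /forall_inPn[q hq]; rewrite negbK; exists q.
  rewrite in_set in x1; rewrite in_set in x2.
  have [r0 r0Q k0] := row x x0; have [r1 r1Q k1] := row _ x1; have [r2 r2Q k2] := row _ x2.
  have e1 : r1 + q2' = q2 + r0.
    apply: quad => //; rewrite -grpN; apply: mem_eq (grpB k1 k0) _; rewrite eg'; zmod.
  have e2 : r2 + q1' = q1 + r1.
    apply: quad => //; rewrite -grpN; apply: mem_eq (grpB k2 k1) _; rewrite eg; zmod.
  apply/PP; exists r2, r0; split=> //; rewrite FinRing.zmodMgE eg eg'.
  apply: zmod_eq2 (esym e1) (esym e2) _; zmod.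
have [t tK /eqP] := K1; apply.
have : t \in Group gP.
  by apply: (sA (Group gP) a0) => x xA; apply/PP; exists x, a0; rewrite inE xA.
move=> /PP[q [q' [h h' e]]]; have [_ _ _ one] := mc.
by rewrite e (one q q') ?subrr // -e.
Qed.

End MixedClosed.

(** * Spanning classes *)

Lemma proper_not_spanning (G : finZmodType) (S : {set G}) (H : {group G}) (g : G) :
  spanning S -> H \proper [set: G] -> (forall x, x \in S -> x - g \in H) -> False.
Proof.
move=> sp /properP[_ [x _ /negP hx]] hS; apply: hx; exact: sp hS x.
Qed.

Section MinimalCounterexample.
Variables (G : finZmodType) (c : G -> 'I_3).
Hypotheses (hodd : odd #|G|) (rf : rainbow_free c).
Hypothesis hne : forall i, exists x, c x = i.
Hypothesis sp : forall i, spanning (color_class c i).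
Hypothesis periodic_case : forall (K : {group G}) (d : G -> 'I_3),
  (exists2 t, t \in K & t != 0) -> rainbow_free d -> (forall i, exists x, d x = i) ->
  (forall x t, t \in K -> d (x + t) = d x) -> class_in_proper_coset d.
Implicit Types (K H T : {group G}) (x y z : G).

Lemma class_not_in_coset i H g : (forall x, c x = i -> x - g \in H) -> forall x, x \in H.
Proof. by move=> h; apply: (sp (i := i) (g := g)) => x; rewrite inE => /eqP; apply: h. Qed.

Section Wild.
(* Recoloring the exceptional coset e + T by a color that occurs in it keeps the coloring
   rainbow-free and makes it T-periodic. *)
Variables (T : {group G}) (e : G) (a : 'I_3).
Hypothesis monoT : forall x, x - e \notin T -> forall t, t \in T -> c (x + t) = c x.
Hypothesis properT : ~ forall x, x \in T.

Definition recolor j x := if x - e \in T then j else c x.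

(** A rainbow progression has at most one point in [e + T]. Move it to a point of that coset with
    true color [j] and compensate by moving another point within its own [T]-coset, which is
    monochromatic. *)
Lemma recolor_rf j : (exists2 t, t \in T & c (e + t) = j) -> rainbow_free (recolor j).
Proof.
move=> [t0 ht0 et0] x y z; rewrite /is_3ap => exyz.
have mono x' y' : x' - e \notin T -> y' - x' \in T -> c y' = c x'.
  by move=> h h'; rewrite -(monoT h h') addrC subrK.
rewrite /rainbow /recolor.
have [hx|hx] := boolP (x - e \in T); have [hy|hy] := boolP (y - e \in T);
  have [hz|hz] := boolP (z - e \in T) => -[//].
- move=> n1 n2 n3; apply: (rf (x := e + t0) (y := y + (x - (e + t0))) (z := z)).
    by rewrite /is_3ap -exyz; zmod.
  rewrite /rainbow et0 (mono y) //; apply: mem_eq (grpB hx ht0) _; zmod.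
- move=> n1 n2 n3; apply: (rf (x := x + (y - (e + t0))) (y := e + t0) (z := z)).
    by rewrite /is_3ap -exyz; zmod.
  rewrite /rainbow et0 (mono x) //; apply: mem_eq (grpB hy ht0) _; zmod.
- move=> n1 n2 n3; apply: (rf (x := x + (e + t0 - z) *+ 2) (y := y) (z := e + t0)).
    by rewrite /is_3ap; apply: zmod_eq1 exyz _; zmod.
  rewrite /rainbow et0 (mono x) //.
  apply: mem_eq (grpMn 2 (grpB ht0 hz)) _; zmod.
- by move=> n1 n2 n3; apply: (rf exyz).
Qed.

Lemma recolor_periodic j x t : t \in T -> recolor j (x + t) = recolor j x.
Proof.
move=> ht; rewrite /recolor addrAC (grpDr _ ht).
by case: ifP => // /negbT h; apply: monoT.
Qed.

(** Apply [periodic_case] to the recoloring. Its class [j] contains the original one, which spans,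
    so the class found is [a] or [j']. In the latter case [e] is outside the coset of [H], for
    otherwise the part of [j'] hidden in [e + T] would lie in it as well. *)
Lemma recolor_class j j' : tri a j j' -> (exists2 t, t \in T & t != 0) ->
  (exists2 t, t \in T & c (e + t) = j) -> (exists2 x, x - e \notin T & c x = a) ->
  (exists H g, [/\ H \proper [set: G], forall x, c x = a -> x - e \notin T -> x - g \in H
    & forall t, t \in T -> t \in H]) \/
  exists H g, [/\ forall x, c x = j' -> x - e \notin T -> x - g \in H,
    e - g \notin H & forall t, t \in T -> t \in H].
Proof.
move=> t0 nT hj [s sT cs].
have out i : exists2 x, x - e \notin T & c x = i.
  have := @class_not_in_coset i T e; have [/existsP[x /andP[h /eqP h']] _|] :=
    boolP [exists x, (x - e \notin T) && (c x == i)]; first by exists x.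
  rewrite negb_exists => /forallP h h'; case: properT; apply: h' => x hx.
  by have := h x; rewrite hx eqxx andbT negbK.
have [i|x t ht|i [H [g [pH hH]]]] := @periodic_case T (recolor j) nT (recolor_rf hj).
- have [x hx <-] := out i; exists x; by rewrite /recolor (negbTE hx).
- exact: recolor_periodic.
have TH : i <> j -> forall t, t \in T -> t \in H.
  move=> ij t ht; have [x hx cx] := out i.
  have hr : recolor j x = i by rewrite /recolor (negbTE hx).
  have := hH _ hr; rewrite -(recolor_periodic j x ht) in hr; have := hH _ hr => h1 h2.
  apply: mem_eq (grpB h1 h2) _; zmod.
have hc x : c x = i -> x - e \notin T -> x - g \in H.
  by move=> cx hx; apply: hH; rewrite /recolor (negbTE hx).
case: (triP t0 i) => ei; subst i.
- left; exists H, g; split=> //; apply: TH; by case/tri_neq: t0.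
- case: (proper_not_spanning (S := color_class c j) (g := g) _ pH) => // x.
  rewrite inE => /eqP cx; apply: hH; rewrite /recolor; by case: ifP.
- right; exists H, g; have TH' := TH (fun q => (let: And3 _ h _ := tri_neq t0 in h) (esym q)).
  split=> //; apply/negP => he.
  case/properP: pH => _ [y _ /negP]; apply; apply: (@class_not_in_coset j' H g) => x cx.
  have [/TH' h|h] := boolP (x - e \in T); last exact: hc.
  by apply: mem_eq (grpD h he) _; zmod.
Qed.

End Wild.

Section MonochromaticCoset.
Variables (K : {group G}) (a b k : 'I_3).
Hypothesis tabk : tri a b k.

Definition meets_both (L : {group G}) x :=
  (exists2 t, t \in L & c (x + t) = b) /\ (exists2 t, t \in L & c (x + t) = k).

(* The union S of the cosets of color a is symmetric about every coset meeting both b and k,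
   so these lie in a single coset of the translation stabilizer T of S. *)
Lemma no_monochromatic_coset :
  (forall x, (forall t, t \in K -> c (x + t) = c x) \/ meets_both K x) ->
  (exists s, forall t, t \in K -> c (s + t) = a) ->
  (exists e, meets_both K e) -> False.
Proof.
move=> rows [s0 hs0] [e heK].
have [nab nbk nak] := tri_neq tabk.
pose S := [set s | [forall (t | t \in K), c (s + t) == a]].
have SP s : reflect (forall t, t \in K -> c (s + t) = a) (s \in S).
  by rewrite inE; apply: (iffP forall_inP) => h t ht; apply/eqP; apply: h.
pose T := [group of tstab S].
have Sc s : s \in S -> c s = a by move=> /SP/(_ _ (grp0 K)); rewrite addr0.
have ST s t : s \in S -> t \in T -> s + t \in S by move=> hs /tstabP; apply.
have KT t : t \in K -> t \in T.
  move=> ht; apply/tstabP => s /SP hs; apply/SP => u hu; rewrite -addrA.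
  by apply: hs; apply: grpD.
have both_sub x : meets_both K x -> meets_both T x.
  by move=> [[t /KT h1 h2] [u /KT h3 h4]]; split; [exists t | exists u].
have heT := both_sub _ heK.
(* Each point of the reflected coset ends two progressions that start in color [a]: the one with
   middle [b] excludes [k], and the one with middle [k] excludes [b]. *)
have refl x s : meets_both T x -> s \in S -> x *+ 2 - s \in S.
  move=> [[t ht et] [u hu eu]] hs; apply/SP => w /KT hw.
  have hcol v : v \in T -> c (s + (v *+ 2 - w)) = a.
    by move=> hv; apply: Sc; apply: ST => //; apply: grpB => //; apply: grpMn.
  have eqv v : s + (v *+ 2 - w) + (x *+ 2 - s + w) = (x + v) *+ 2 by zmod.
  have [//|h1] := end_color rf tabk (eqv t) (hcol t ht) et.
  have [//|h2] := end_color rf (triR (triC tabk)) (eqv u) (hcol u hu) eu.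
  by case: nbk; rewrite -h1.
have both_eT x : meets_both T x -> x - e \in T.
  move=> hx; rewrite -(grp_dbl hodd); apply/tstabP => s hs.
  apply: mem_eq (refl _ _ hx (refl _ _ heT hs)) _; zmod.
have hs0S : s0 \in S by apply/SP.
have S_out s : s \in S -> s - e \notin T.
  move=> hs; apply/negP => h; have [[t ht et] _] := heT.
  have /Sc : s + (t - (s - e)) \in S by apply: ST => //; apply: grpB.
  have -> : s + (t - (s - e)) = e + t by zmod.
  by rewrite et => /esym.
have properT : ~ forall x, x \in T by move=> h; have := S_out _ hs0S; rewrite h.
have inS x : x - e \notin T -> c x = a -> x \in S.
  move=> hx cx; apply/SP => t ht; have [->//|/both_sub/both_eT h] := rows x.
  by rewrite h in hx.
have monoT x : x - e \notin T -> forall t, t \in T -> c (x + t) = c x.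
  move=> hx t ht; have hxt : x + t - e \notin T by rewrite addrAC (grpDr _ ht).
  case: (triP tabk (c x)) => cx.
  - by rewrite cx; apply: Sc; apply: ST => //; apply: inS.
  - case: (triP tabk (c (x + t))) => cxt; last 2 first.
    + by rewrite cx.
    + by case/negP: hx; apply: both_eT; split; [exists 0; rewrite ?grp0 ?addr0 | exists t].
    have /Sc : x + t - t \in S by apply: ST; rewrite ?grpN //; apply: inS.
    by rewrite addrK cx => /esym.
  - case: (triP tabk (c (x + t))) => cxt; last 2 first.
    + by case/negP: hx; apply: both_eT; split; [exists t | exists 0; rewrite ?grp0 ?addr0].
    + by rewrite cx.
    have /Sc : x + t - t \in S by apply: ST; rewrite ?grpN //; apply: inS.
    by rewrite addrK cx => /esym.
have [t1 ht1 et1] : exists2 t, t \in T & c (e + t) = b by case: heT.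
have [t2 ht2 et2] : exists2 t, t \in T & c (e + t) = k by case: heT.
have nT : exists2 t, t \in T & t != 0.
  exists (t1 - t2); first exact: grpB.
  by rewrite subr_eq0; apply/eqP => h; rewrite h et2 in et1; case: nbk.
have hS : exists2 x, x - e \notin T & c x = a by exists s0; [apply: S_out | apply: Sc].
(* The class a is the set S together with part of e + T, and S is symmetric about e. *)
have not_a H g : H \proper [set: G] -> (forall x, c x = a -> x - e \notin T -> x - g \in H) ->
    (forall t, t \in T -> t \in H) -> False.
  move=> pH hH TH.
  have hSg s : s \in S -> s - g \in H by move=> hs; apply: hH; [apply: Sc | apply: S_out].
  have heg : e - g \in H.
    rewrite -(grp_dbl hodd); apply: mem_eq (grpD (hSg _ hs0S) (hSg _ (refl _ _ heT hs0S))) _.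
    zmod.
  case/properP: pH => _ [y _ /negP]; apply; apply: (@class_not_in_coset a H g) => x cx.
  have [/TH h|h] := boolP (x - e \in T); last exact: hH.
  by apply: mem_eq (grpD h heg) _; zmod.
have trec j j' : tri a j j' -> (exists2 t, t \in T & c (e + t) = j) ->
    exists H g, [/\ forall x, c x = j' -> x - e \notin T -> x - g \in H,
      e - g \notin H & forall t, t \in T -> t \in H].
  move=> t hj; have [[H [g [pH h1 h2]]]|//] := recolor_class monoT properT t nT hj hS.
  by case: (not_a H g).
have tri' : tri a k b by apply: triR (triC tabk).
pose out j x := c x = j /\ x - e \notin T.
(* Outside [e + T] the reflection in [e] and the doubling away from [e] exchange [j] and [j']. With
   [e + T] recolored [j'], the image has color [j] or [j']; color [j] would put [e] into the coset
   of [H] containing the outer part of [j]. *)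
have flip j j' : tri a j j' -> (exists2 t, t \in T & c (e + t) = j) ->
    (exists2 t, t \in T & c (e + t) = j') ->
    forall x, out j x -> out j' (e *+ 2 - x) /\ out j' (x *+ 2 - e).
  move=> t hj hj' x [cx hx].
  have [H [g [hH heg TH]]] := trec _ _ (triR (triC t)) hj'.
  have tj : tri j j' a by apply: triR.
  have rj := recolor_rf monoT hj'.
  have re : recolor T e j' e = j' by rewrite /recolor subrr grp0.
  have rx : recolor T e j' x = j by rewrite /recolor (negbTE hx).
  split; split.
  - have hy : e *+ 2 - x - e \notin T.
      by rewrite (_ : _ - e = - (x - e)) ?grpN //; zmod.
    have exy : x + (e *+ 2 - x) = e *+ 2 by zmod.
    have := end_color rj tj exy rx re; rewrite /recolor (negbTE hy) => -[cy|//].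
    case/negP: heg; rewrite -(grp_dbl hodd).
    apply: mem_eq (grpD (hH _ cx hx) (hH _ cy hy)) _; zmod.
  - by rewrite (_ : _ - e = - (x - e)) ?grpN //; zmod.
  - have hy : x *+ 2 - e - e \notin T.
      by rewrite (_ : _ - e = (x - e) *+ 2) ?(grp_dbl hodd) //; zmod.
    have exy : e + (x *+ 2 - e) = x *+ 2 by zmod.
    have := end_color rj (triC tj) exy re rx; rewrite /recolor (negbTE hy) => -[//|cy].
    case/negP: heg; apply: mem_eq (grpB (grpMn 2 (hH _ cx hx)) (hH _ cy hy)) _; zmod.
  - by rewrite (_ : _ - e = (x - e) *+ 2) ?(grp_dbl hodd) //; zmod.
have hb : exists2 t, t \in T & c (e + t) = b by exists t1.
have hk : exists2 t, t \in T & c (e + t) = k by exists t2.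
(* The midpoint of [x'] and the reflection of [x] is [e + halve (x' - x)]. If it lay outside
   [e + T], either it or its reflection in [e] would be an outer point of color [b], forcing [e]
   into the coset of [H]. *)
have single x x' : out b x -> out b x' -> x' - x \in T.
  move=> hx hx'; have [[cy hy] _] := flip _ _ tabk hb hk x hx.
  have [H [g [hH heg TH]]] := trec _ _ tri' hk.
  case: (hx) (hx') => cx nx [cx' nx'].
  have exy : x' + (e *+ 2 - x) = (e + halve (x' - x)) *+ 2.
    by rewrite mulrnDl (halveK hodd); zmod.
  have hd : halve (x' - x) \in H.
    by rewrite (grp_halve hodd); apply: mem_eq (grpB (hH _ cx' nx') (hH _ cx nx)) _; zmod.
  have rx' : recolor T e b x' = b by rewrite /recolor (negbTE nx').
  have ry : recolor T e b (e *+ 2 - x) = k by rewrite /recolor (negbTE hy).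
  have := mid_color (recolor_rf monoT hb) (triR tabk) exy rx' ry.
  rewrite -(grp_halve hodd) /recolor [e + _]addrC addrK.
  have [//|hm] := boolP (halve _ \in T) => -[cm|cm].
    case/negP: heg; apply: mem_eq (grpB (hH _ cm _) hd) _; last by zmod.
    by rewrite addrK.
  have hmo : out k (halve (x' - x) + e) by split; rewrite ?addrK.
  have [[cm' hm'] _] := flip _ _ tri' hk hb _ hmo.
  case/negP: heg; apply: mem_eq (grpD (hH _ cm' hm') hd) _; zmod.
(* [S] is stable under reflections in the class [b]: points of that class in [e + T] are covered by
   [refl], and [flip] and [single] settle the outer ones. *)
have all_S x : x \in S.
  apply: (spanning_reflection hodd (sp (i := b))) => [||y s]; first by exists s0.
    by have [y <-] := hne b; exists y; rewrite inE.
  rewrite inE => /eqP cy hs.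
  have [hy|hy] := boolP (y - e \in T).
    apply: refl => //; split; [exists 0 | exists (e + t2 - y)].
    - exact: grp0.
    - by rewrite addr0.
    - by apply: mem_eq (grpB ht2 hy) _; zmod.
    - by rewrite addrC subrK.
  have hyb : out b y by [].
  have [_ [cw hw]] := flip _ _ tabk hb hk y hyb.
  have esy : s + (y *+ 2 - s) = y *+ 2 by zmod.
  have hr : y *+ 2 - s - e \notin T.
    apply/negP => h; have /Sc : s + (y *+ 2 - s - e) \in S by apply: ST.
    have -> : s + (y *+ 2 - s - e) = y *+ 2 - e by zmod.
    by rewrite cw => /esym.
  have [h|h] := end_color rf tabk esy (Sc _ hs) cy; first exact: inS.
  have := single _ _ hyb (conj h hr : out b _) => h'.
  have /Sc : s + (y *+ 2 - s - y) \in S by apply: ST.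
  have -> : s + (y *+ 2 - s - y) = y by zmod.
  by rewrite cy => /esym.
have := all_S e => /Sc he; have /Sc := all_S (e + t1).
by rewrite et1 => /esym.
Qed.

End MonochromaticCoset.

(** If [i] fills whole [K]-cosets, every other coset is monochromatic or meets both remaining
    colors. Either [c] is periodic, or [no_monochromatic_coset] applies. *)
Lemma class_not_periodic K i : (exists2 t, t \in K & t != 0) ->
  (forall x t, t \in K -> c x = i -> c (x + t) = i) -> False.
Proof.
move=> K1 per; have [b [k t]] := tri_complete i; have [ib bk ik] := tri_neq t.
have perN x u : u \in K -> c (x + u) = i -> c x = i.
  by move=> uK cxu; rewrite -[x](addrK u); apply: per; rewrite ?grpN.
case: (boolP [exists x, exists u, (u \in K) && (c (x + u) != c x)]).
  case/existsP => e /existsP[u /andP[uK /eqP ne]].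
  have both x v : v \in K -> c (x + v) <> c x -> meets_both b k K x.
    move=> vK nex; have x0 : c (x + 0) = c x by rewrite addr0.
    case: (triP t (c x)) => cx; case: (triP t (c (x + v))) => cxv.
    - by case: nex; rewrite cx.
    - by case: nex; rewrite cx; apply: per.
    - by case: nex; rewrite cx; apply: per.
    - by case: nex; rewrite (perN x v).
    - by case: nex; rewrite cx.
    - by split; [exists 0; rewrite ?grp0 ?x0 | exists v].
    - by case: nex; rewrite (perN x v).
    - by split; [exists v | exists 0; rewrite ?grp0 ?x0].
    - by case: nex; rewrite cx.
  apply: (no_monochromatic_coset (K := K) t); last by exists e; apply: both ne.
    move=> x; case: (boolP [forall (v | v \in K), c (x + v) == c x]) => [/forall_inP h|].
      by left=> v /h/eqP.
    by case/forall_inPn => v vK /eqP h; right; apply: both h.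
  by have [s cs] := hne i; exists s => v vK; apply: per.
rewrite negb_exists => /forallP h.
have [|j [H [g [pH hH]]]] := periodic_case K1 rf hne.
  move=> x u uK; apply/eqP; have := h x; rewrite negb_exists => /forallP/(_ u).
  by rewrite uK negbK.
by case/properP: pH => _ [y _ /negP]; apply; apply: class_not_in_coset hH y.
Qed.

(** * Color counts in the cosets (rows) of a subgroup of prime order *)

Section PrimeRows.
Variable K : {group G}.
Hypothesis Kp : prime #|K|.
Local Notation p := #|K|.

Definition slice i x : {set G} := [set t in K | c (x + t) == i].
Local Notation n i x := #|slice i x|.

Lemma sliceP i x t : reflect (t \in K /\ c (x + t) = i) (t \in slice i x).
Proof. by rewrite inE; apply: (iffP andP) => -[h /eqP]. Qed.

Lemma slice_gt0 i x : reflect (exists2 t, t \in K & c (x + t) = i) (0 < n i x)%N.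
Proof.
apply: (iffP card_gt0P) => [[t /sliceP[h1 h2]]|[t h1 h2]]; first by exists t.
by exists t; apply/sliceP.
Qed.

Lemma slice_shift i x t : t \in K -> n i (x + t) = n i x.
Proof.
move=> tK; rewrite -(card_imset (mem (slice i (x + t))) (addrI t)); apply: eq_card => u.
apply/imsetP/sliceP => [[v /sliceP[h1 h2] ->]|[h1 h2]].
  by rewrite addrA; split=> //; apply: grpD.
exists (u - t); last by rewrite addrC subrK.
by apply/sliceP; split; [apply: grpB | rewrite -addrA [t + _]addrC subrK].
Qed.

Lemma slice_sum a b k x : tri a b k -> (n a x + n b x + n k x = p)%N.
Proof.
move=> t; have [ab bk ak] := tri_neq t.
have -> : p = #|slice a x :|: slice b x :|: slice k x|.
  apply: eq_card => u; rewrite !inE -!andb_orr.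
  by case: (triP t (c (x + u))) => ->; rewrite eqxx ?orbT andbT.
have disj i j : i <> j -> slice i x :&: slice j x = set0.
  by move=> ij; apply/setP => u; rewrite in_set0; apply/setIP => -[/sliceP[_ h1] /sliceP[_ h2]]; case: ij; rewrite -h1.
by rewrite !cardsU setIUl !disj // setU0 cards0 !subn0.
Qed.

(** Inside [K] the doubles of the slice of [h] at the midpoint avoid the sumset of the other two
    slices, and Cauchy-Davenport bounds that sumset from below. *)
Lemma slice_bound i j h x y z : tri i j h -> x + y = z *+ 2 ->
  (0 < n i x)%N -> (0 < n j y)%N -> (n h z + minn p (n i x + n j y).-1 <= p)%N.
Proof.
move=> t e; rewrite !card_gt0 => h1 h2.
have sK l w : slice l w \subset K by apply/subsetP => u /sliceP[].
apply: leq_trans (leq_add (leqnn _) (cauchy_davenport Kp (sK _ _) (sK _ _) h1 h2)) _.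
have -> : n h z = #|dblset (slice h z)| by rewrite card_imset //; apply: dbl_inj.
rewrite -cardsUI (_ : _ :&: _ = set0) ?cards0 ?addn0.
  apply: subset_leq_card; apply/subsetP => w /setUP[/imsetP[u /sliceP[uK _] ->]|].
    exact: grpMn.
  by case/sumsetP => u [v [/sliceP[uK _] /sliceP[vK _] ->]]; apply: grpD.
apply/setP => w; rewrite in_set0; apply/setIP => -[/imsetP[m /sliceP[mK cm] ->]].
case/sumsetP => u [v [/sliceP[uK cu] /sliceP[vK cv] e']].
apply: (no_rainbow rf t _ cu cv cm); apply: zmod_eq2 e (esym e') _; zmod.
Qed.

Lemma slice_singleton x : (forall i, 0 < n i x)%N -> exists i, n i x = 1%N.
Proof.
move=> h; have rf' : rainbow_free (fun t => c (x + t)).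
  by move=> u v w e; apply: rf; rewrite /is_3ap; apply: zmod_eq1 e _; zmod.
have [|i [t [tK ct ut]]] := prime_coset_singleton Kp rf'; first by move=> i; apply/slice_gt0.
exists i; apply/eqP/cards1P; exists t; apply/setP => u; rewrite in_set1.
by apply/sliceP/eqP => [[h1 h2]|->]; [apply: ut | split].
Qed.

Lemma p_gt2 : (2 < p)%N.
Proof.
have := prime_gt1 Kp; rewrite leq_eqVlt => /predU1P[e|//].
by have := cardSg (subsetT K); rewrite cardsT -e dvdn2 hodd.
Qed.

Lemma not_both_one (u v : nat) : (u + v = p)%N -> u = 1%N -> v = 1%N -> False.
Proof. by move=> s eu ev; have := p_gt2; rewrite -s eu ev. Qed.

Lemma K_nontrivial : exists2 t, t \in K & t != 0.
Proof. by have := prime_gt1 Kp; rewrite cardG_gt1 => /trivgPn. Qed.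

(** * Three-colored rows *)

Section Apex.
Variables a b k : 'I_3.
Hypothesis tabk : tri a b k.

Definition apex x := [/\ c x = a, n a x = 1%N, (0 < n b x)%N & (0 < n k x)%N].

Lemma apex_unique x t : apex x -> t \in K -> c (x + t) = a -> t = 0.
Proof.
move=> [cx na _ _] tK ct; have /card_le1_eqP : (n a x <= 1)%N by rewrite na.
by apply; apply/sliceP; rewrite ?grp0 ?addr0.
Qed.

Lemma apex_symmetric x i t : apex x -> i <> a -> t \in slice i x ->
  [/\ t != 0, - t \in slice i x, t *+ 2 \in slice i x & halve t \in slice i x].
Proof.
move=> ax ia /sliceP[tK ct]; have [cx _ _ _] := ax; have [h th] := tri_exists ia.
have t0 : t != 0 by apply/eqP => e; case: ia; rewrite -ct -cx e addr0.
have out u : u \in K -> u != 0 -> c (x + u) = a -> False.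
  by move=> uK /eqP u0 /(apex_unique ax uK).
have e1 : (x + t) + (x - t) = x *+ 2 by zmod.
have e2 : x + (x + t *+ 2) = (x + t) *+ 2 by zmod.
have e3 : x + (x + t) = (x + halve t) *+ 2 by rewrite mulrnDl (halveK hodd); zmod.
have d0 := dbl_eq0 hodd.
split=> //; apply/sliceP; split; rewrite ?grpN ?grpMn ?(grp_halve hodd) //.
- case: (end_color rf th e1 ct cx) => // /out[]; by rewrite ?grpN ?oppr_eq0.
- case: (end_color rf (triC th) e2 cx ct) => // /out[]; by rewrite ?grpMn ?d0.
- case: (mid_color rf (triC th) e3 cx ct) => // /out[]; first by rewrite (grp_halve hodd).
  by rewrite -d0 (halveK hodd).
Qed.

(** Both other slices contain [t] and [- t], so the order of [K] is at least [5]. Then [t *+ 3] is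
    nonzero and [t *+ 2] is a third element. *)
Lemma apex_card x : apex x -> (3 <= n b x)%N && (3 <= n k x)%N.
Proof.
move=> ax; have [cx na nb nk] := ax; have [ab bk ak] := tri_neq tabk.
have two i : i <> a -> (0 < n i x)%N ->
    exists t, [/\ t \in K, t != 0, [set t; - t; t *+ 2] \subset slice i x & [set t; - t] \subset slice i x].
  move=> ia /card_gt0P[t ht]; have [t0 h1 h2 _] := apex_symmetric ax ia ht.
  exists t; have /sliceP[tK _] := ht; split=> //; apply/subsetP => u; rewrite !inE.
    by case/orP => [/orP[]|] /eqP->; move: ht h1 h2; rewrite !inE.
  by case/orP => /eqP->; move: ht h1 h2; rewrite !inE.
have d0 := dbl_eq0 hodd.
have tN (t : G) : t != 0 -> t != - t.
  move=> t0; apply/eqP => e; case/negP: t0; rewrite -d0; apply/eqP; apply: zmod_eq1 e _; zmod.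
have ge2 i : i <> a -> (0 < n i x)%N -> (2 <= n i x)%N.
  by move=> ia /(two _ ia)[t [tK t0 _ /subset_leq_card]]; rewrite cards2 tN.
have p5 : (4 < p)%N.
  by rewrite -(slice_sum x tabk) na; have := ge2 b (nesym ab) nb; have := ge2 k (nesym ak) nk; lia.
have ge3 i : i <> a -> (0 < n i x)%N -> (3 <= n i x)%N.
  move=> ia /(two _ ia)[t [tK t0 /subset_leq_card h _]]; apply: leq_trans h.
  rewrite cardsU cards2 tN //= cards1 (_ : _ :&: _ = set0) ?cards0 //.
  apply/setP => u; rewrite !inE; apply/negP => /andP[/orP[]/eqP-> /eqP e].
    by case/eqP: t0; apply: zmod_eq1 (esym e) _; zmod.
  have t3 : t *+ 3 = 0 by apply: zmod_eq1 (esym e) _; zmod.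
  have o3 : (#[t]%g %| 3)%N by rewrite order_dvdn; apply/eqP.
  have op : (#[t]%g %| p)%N by apply: order_dvdG.
  have := Kp => /primeP[_ /(_ _ op)]/orP[]/eqP o.
    by case/eqP: t0; apply/eqP; move/eqP: o; rewrite order_eq1.
  by move: o3; rewrite o => /dvdn_leq; lia.
by rewrite !ge3 //; apply: nesym.
Qed.

(** The bounds of [slice_bound] on the three color counts in the row of the midpoint do not leave
    room for a total of [p]; the same method gives [apex_row_other]. *)
Lemma apex_row_two x y : apex x -> (0 < n a y)%N -> (0 < n b y)%N -> n k y = 0%N -> False.
Proof.
move=> ax ya yb yk; have [cx xa xb xk] := ax.
have /andP[b3 k3] := apex_card ax.
have e : x + y = halve (x + y) *+ 2 by rewrite (halveK hodd).
set z := halve (x + y) in e.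
have sx := slice_sum x tabk; have sy := slice_sum y tabk; have sz := slice_sum z tabk.
have xa' : (0 < n a x)%N by rewrite xa.
have h1 := slice_bound tabk e xa' yb.
have h2 := slice_bound (triC tabk) e xb ya.
have h3 := slice_bound (triC (triR (triC tabk))) e xk ya.
have h4 := slice_bound (triC (triR tabk)) e xk yb.
move: (n a x) (n b x) (n k x) (n a y) (n b y) (n k y) (n a z) (n b z) (n k z) xa xb xk ya yb yk
  b3 k3 sx sy sz h1 h2 h3 h4 p_gt2; clear; lia.
Qed.

Lemma apex_row_other x y : apex x -> n b y = 1%N -> (0 < n a y)%N -> (3 <= n k y)%N ->
  (3 <= n a y)%N -> False.
Proof.
move=> ax yb ya yk ya3; have [cx xa xb xk] := ax.
have /andP[b3 k3] := apex_card ax.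
have e : x + y = halve (x + y) *+ 2 by rewrite (halveK hodd).
set z := halve (x + y) in e.
have sx := slice_sum x tabk; have sy := slice_sum y tabk; have sz := slice_sum z tabk.
have xa' : (0 < n a x)%N by rewrite xa.
have yk' : (0 < n k y)%N by apply: leq_trans yk.
have h2 := slice_bound (triC tabk) e xb ya.
have h3 := slice_bound (triC (triR (triC tabk))) e xk ya.
have h4 := slice_bound (triR tabk) e xb yk'.
move: (n a x) (n b x) (n k x) (n a y) (n b y) (n k y) (n a z) (n b z) (n k z) xa xb xk ya yb yk
  b3 k3 ya3 sx sy sz h2 h3 h4 p_gt2; clear; lia.
Qed.

End Apex.

Lemma apex_swap a b k x : apex a b k x -> apex a k b x.
Proof. by case. Qed.

Lemma apex_rows a b k x y : tri a b k -> apex a b k x -> (0 < n a y)%N ->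
  n a y = p \/ [/\ n a y = 1%N, (0 < n b y)%N & (0 < n k y)%N].
Proof.
move=> t ax ya; have t' : tri a k b := triR (triC t).
have sy := slice_sum y t.
case: (posnP (n b y)) => yb; case: (posnP (n k y)) => yk.
- by left; rewrite -sy yb yk !addn0.
- by case: (apex_row_two t' (apex_swap ax) ya yk yb).
- by case: (apex_row_two t ax ya yb yk).
have pos i : (0 < n i y)%N by case: (triP t i) => ->.
have [i ni] := slice_singleton pos.
have apex_at j j' j'' : i = j -> tri j j' j'' -> (3 <= n j' y)%N && (3 <= n j'' y)%N.
  move=> ij tj; have /slice_gt0[u uK cu] := pos i; rewrite -(slice_shift _ y uK) -(slice_shift j'' y uK).
  by apply: (apex_card tj); split; rewrite ?slice_shift // -ij.
case: (triP t i) => ei.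
- by right; rewrite -ni ei.
- have /andP[h1 h2] := apex_at _ _ _ ei (triR t).
  by case: (apex_row_other t ax _ ya h1 h2); rewrite -ei.
- have /andP[h1 h2] := apex_at _ _ _ ei (triC (triR t)).
  by case: (apex_row_other t' (apex_swap ax) _ ya h1 h2); rewrite -ei.
Qed.

Lemma full_slice i x t : n i x = p -> t \in K -> c (x + t) = i.
Proof.
move=> e tK; have : slice i x = K; last by move=> h; move: tK; rewrite -h => /sliceP[].
apply/eqP; rewrite eqEcard e leqnn andbT; apply/subsetP => u /sliceP[] //.
Qed.

Lemma color_slice_gt0 x : (0 < n (c x) x)%N.
Proof. by apply/slice_gt0; exists 0; rewrite ?grp0 ?addr0. Qed.

(* All apices carry the same pattern, and the set Q of points carrying it is stable under
   reflections in the class a. *)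
Lemma no_apex a b k x0 : tri a b k -> apex a b k x0 -> False.
Proof.
move=> t ax0; have [ab bk ak] := tri_neq t.
have rows x := @apex_rows a b k x0 x t ax0.
have [s hs|nomono] := pickP (fun s => n a s == p).
  apply: (no_monochromatic_coset (K := K) t) => [x||]; last 2 first.
  - by exists s => u uK; apply: full_slice => //; apply/eqP.
  - by have [_ _ /slice_gt0 hb /slice_gt0 hk] := ax0; exists x0.
  have sx := slice_sum x t.
  case: (posnP (n a x)) => [xa|/rows[xa|[_ /slice_gt0 xb /slice_gt0 xk]]]; last by right.
    case: (posnP (n b x)) => xb; last case: (posnP (n k x)) => xk.
    - have e : n k x = p by rewrite -sx xa xb.
      by left=> u uK; rewrite (full_slice e uK) -{1}[x]addr0 (full_slice e (grp0 K)).
    - have e : n b x = p by rewrite -sx xa xk addn0.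
      by left=> u uK; rewrite (full_slice e uK) -{1}[x]addr0 (full_slice e (grp0 K)).
    - by right; split; apply/slice_gt0.
  by left=> u uK; rewrite (full_slice xa uK) -{1}[x]addr0 (full_slice xa (grp0 K)).
have all_apex x : c x = a -> apex a b k x.
  move=> cx; have := color_slice_gt0 x; rewrite cx => /rows[/eqP|[]]; last by split.
  by rewrite nomono.
(* If [y + u] had color [j], then [halve (x + y) + halve u] would be the midpoint of an [a] and an
   [i] and also of an [a] and a [j], hence of color [a]. The same holds for [- u], giving two points
   of color [a] in one row. *)
have same i j x y u : tri a i j -> apex a i j x -> c x = a -> c y = a ->
    u \in slice i x -> u \in slice i y.
  move=> tij axi cx cy hu; have [ai ij aj] := tri_neq tij.
  have [u0 hN _ _] := apex_symmetric axi (nesym ai) hu.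
  have midA v : v \in slice i x -> c (y + v) = j -> c (halve (x + y) + halve v) = a.
    move=> /sliceP[vK cv] cyv.
    have e1 : y + (x + v) = (halve (x + y) + halve v) *+ 2.
      by rewrite mulrnDl !(halveK hodd); zmod.
    have e2 : x + (y + v) = (halve (x + y) + halve v) *+ 2.
      by rewrite mulrnDl !(halveK hodd); zmod.
    have [//|h1] := mid_color rf tij e1 cy cv.
    have [//|h2] := mid_color rf (triR (triC tij)) e2 cx cyv.
    by case: ij; rewrite -h1.
  have /sliceP[uK cxu] := hu; apply/sliceP; split=> //.
  have ayi := all_apex y cy.
  case: (triP tij (c (y + u))) => // cyu.
    by case/eqP: u0; apply: apex_unique ayi uK cyu.
  have [_ na nb nk] := ayi.
  have posy l : (0 < n l y)%N by case: (triP t l) => -> //; rewrite na.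
  have ayj : apex a j i y by split.
  have huy : u \in slice j y by apply/sliceP.
  have [_ /sliceP[_ hNy] _ _] := apex_symmetric ayj (nesym aj) huy.
  have c1 := midA u hu cyu; have c2 := midA (- u) hN hNy.
  have e : halve (x + y) + halve u + - u = halve (x + y) + halve (- u).
    by rewrite halveN -{2}(halveK hodd u); zmod.
  case/eqP: u0; apply/eqP; rewrite -oppr_eq0; apply/eqP.
  by apply: apex_unique (all_apex _ c1) _ _; rewrite ?grpN // e.
have t' : tri a k b := triR (triC t).
have [cx0 na0 nb0 nk0] := ax0.
pose Vb := slice b x0; pose Vk := slice k x0.
have ax0' := apex_swap ax0.
have symb u := @apex_symmetric a b k x0 b u ax0 (nesym ab).
have symk u := @apex_symmetric a b k x0 k u ax0 (nesym ak).
have inb y u : c y = a -> u \in Vb -> c (y + u) = b.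
  by move=> cy hu; have /sliceP[] := same b k x0 y u t ax0 cx0 cy hu.
have ink y u : c y = a -> u \in Vk -> c (y + u) = k.
  by move=> cy hu; have /sliceP[] := same k b x0 y u t' ax0' cx0 cy hu.
(* Cauchy-Davenport gives [Vb + Vk] at least [p - 2] elements. It is symmetric and omits [0], so
   omitting [w] means omitting the three elements [0], [w] and [- w]. *)
have cover w : w \in K -> w != 0 -> exists u v, [/\ u \in Vb, v \in Vk & w = u *+ 2 - v].
  move=> wK w0.
  have sK l y : slice l y \subset K by apply/subsetP => u /sliceP[].
  have [/sumsetP[u [v [hu hv ->]]]|hw] := boolP (w \in sumset Vb Vk).
    exists (halve u), (- v); rewrite (halveK hodd) opprK.
    by have [_ _ _ ->] := symb _ hu; have [_ -> _ _] := symk _ hv.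
  have inN z : z \in sumset Vb Vk -> - z \in sumset Vb Vk.
    move=> /sumsetP[u [v [hu hv ->]]]; apply/sumsetP; exists (- u), (- v); rewrite opprD.
    by have [_ -> _ _] := symb _ hu; have [_ -> _ _] := symk _ hv.
  have n0 : 0 \notin sumset Vb Vk.
    apply/negP => /sumsetP[u [v [hu hv e]]]; have [_ /sliceP[_ h] _ _] := symb _ hu.
    have /sliceP[_ h'] := hv; case: bk; rewrite -h -h'; congr (c (_ + _)).
    by apply: zmod_eq1 e _; zmod.
  have dis : [set 0; w; - w] :&: sumset Vb Vk = set0.
    apply/setP => z; rewrite in_set0; apply/setIP => -[]; rewrite !in_setU !in_set1.
    case/orP => [/orP[]|] /eqP->; apply/negP => //.
    by apply: contra hw => /inN; rewrite opprK.
  have c3 : #|[set 0; w; - w]| = 3%N.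
    rewrite cardsU cards2 eq_sym w0 cards1 (_ : _ :&: _ = set0) ?cards0 //.
    apply/setP => z; rewrite in_set0; apply/setIP => -[]; rewrite !in_setU !in_set1.
    case/orP => /eqP-> /eqP e; case/negP: w0; first by rewrite -oppr_eq0 -e.
    by rewrite -(dbl_eq0 hodd); apply/eqP; apply: zmod_eq1 e _; zmod.
  have : (#|[set 0%R; w; (- w)%R]| + #|sumset Vb Vk| <= p)%N.
    rewrite -cardsUI dis cards0 addn0; apply: subset_leq_card; apply/subsetP => z.
    rewrite in_setU !in_setU !in_set1 => /orP[/orP[/orP[]|] /eqP->|]; rewrite ?grp0 ?grpN //.
    case/sumsetP => u [v [/sliceP[uK _] /sliceP[vK _] ->]]; exact: grpD.
  have := cauchy_davenport Kp (sK b x0) (sK k x0); rewrite -!card_gt0 nb0 nk0 => /(_ isT isT).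
  have := slice_sum x0 t; rewrite na0 c3 -/Vb -/Vk; move: p_gt2 #|Vb| #|Vk| #|sumset _ _|; clear; lia.
pose Q := [set q | [forall (u | u \in Vb), c (q + u) == b] && [forall (u | u \in Vk), c (q + u) == k]].
have QP q : reflect ((forall u, u \in Vb -> c (q + u) = b) /\ forall u, u \in Vk -> c (q + u) = k) (q \in Q).
  rewrite inE; apply: (iffP andP) => -[h1 h2]; split.
  - by move=> u /(forall_inP h1)/eqP.
  - by move=> u /(forall_inP h2)/eqP.
  - by apply/forall_inP => u /h1/eqP.
  - by apply/forall_inP => u /h2/eqP.
have all_Q q : q \in Q.
  apply: (spanning_reflection hodd (sp (i := a))) => [||y r].
  - by exists x0; apply/QP; split=> u; [apply: inb | apply: ink].
  - by exists x0; rewrite inE cx0.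
  rewrite inE => /eqP cy /QP[rb rk].
  (* By [cover], the point is the far end of a progression that starts in color [k] and has a middle
     of color [b]. *)
  have nota w : w \in K -> w != 0 -> c (y *+ 2 - r + w) <> a.
    move=> wK w0; have [u [v [hu hv ew]]] := cover w wK w0.
    have e : r + v + (y *+ 2 - r + w) = (y + u) *+ 2 by rewrite ew; zmod.
    by have [->|->] := end_color rf (triC (triR t)) e (rk v hv) (inb y u cy hu); apply: nesym.
  apply/QP; split=> u hu.
  - have [u0 hN _ _] := symb _ hu; have /sliceP[uK _] := hu.
    have e : r - u + (y *+ 2 - r + u) = y *+ 2 by zmod.
    by have [|/(nota u uK u0)] := end_color rf (triC t) e (rb _ hN) cy.
  - have [u0 hN _ _] := symk _ hu; have /sliceP[uK _] := hu.
    have e : r - u + (y *+ 2 - r + u) = y *+ 2 by zmod.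
    by have [|/(nota u uK u0)] := end_color rf (triC t') e (rk _ hN) cy.
have /card_gt0P[u hu] := nb0; have /QP[/(_ u hu) h _] := all_Q (x0 - u).
by rewrite subrK cx0 in h.
Qed.

Lemma two_colored_rows x : exists i, n i x = 0%N.
Proof.
case: (boolP [exists i, n i x == 0%N]) => [/existsP[i /eqP]|]; first by exists i.
rewrite negb_exists => /forallP h; exfalso.
have pos i : (0 < n i x)%N by rewrite lt0n h.
have [i ni] := slice_singleton pos; have [b [k t]] := tri_complete i.
have /slice_gt0[u uK cu] := pos i.
by apply: (@no_apex i b k (x + u) t); split; rewrite ?slice_shift.
Qed.

(** * Two-colored rows *)

Definition row2 i j x := (0 < n i x)%N && (0 < n j x)%N.

Lemma row2C i j x : row2 i j x = row2 j i x.
Proof. exact: andbC. Qed.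

Lemma row2_third i j h x : tri i j h -> row2 i j x -> n h x = 0%N /\ (n i x + n j x = p)%N.
Proof.
move=> t /andP[hi hj]; have s := slice_sum x t; have [l hl] := two_colored_rows x.
by case: (triP t l) => e; move: hl; rewrite e; lia.
Qed.

(** Row [z] lacks a color; add the two [slice_bound] inequalities for the other two. Absence of [i]
    forces a single [i] in row [x], absence of [h] a single [h] in row [y], and absence of [j] would
    give [p <= 2]. *)
Lemma mid_row i j h x y z : tri i j h -> row2 i j x -> row2 j h y -> x + y = z *+ 2 ->
  row2 i j z /\ n h y = 1%N \/ row2 j h z /\ n i x = 1%N.
Proof.
move=> t rx ry e; have [xh sx] := row2_third t rx; have [yi sy] := row2_third (triR t) ry.
case/andP: rx => xi xj; case/andP: ry => yj yh.
have b1 := slice_bound t e xi yj.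
have b2 := slice_bound (triR (triC t)) e xi yh.
have b3 := slice_bound (triR t) e xj yh.
have sz := slice_sum z t; have [l zl] := two_colored_rows z.
rewrite /row2; have p2 := p_gt2.
have [[z0 s0]|[z0|[z0 s0]]] : n i z = 0%N /\ (n j z + n h z = p)%N \/ n j z = 0%N \/
    n h z = 0%N /\ (n i z + n j z = p)%N.
  by case: (triP t l) zl => -> zl; [left|right; left|right; right] => //; split=> //; lia.
- by right; split; [apply/andP; split|]; lia.
- by exfalso; lia.
- by left; split; [apply/andP; split|]; lia.
Qed.

(* Taking midpoints with a fixed row of the next type embeds each type properly into the
   next one, cyclically. *)
Lemma three_types_cyclic a b k x0 y0 w0 : tri a b k ->
  row2 a b x0 -> row2 b k y0 -> row2 k a w0 -> n a x0 = 1%N -> False.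
Proof.
move=> t hx0 hy0 hw0 na0; have t2 := triR t; have t3 := triR t2.
have hv (u v : G) : u + v = halve (u + v) *+ 2 by rewrite (halveK hodd).
have W w : row2 k a w -> n k w = 1%N.
  move=> hw; have [_ s] := row2_third t hx0.
  by have [[_ h]|[_ //]] := mid_row t3 hw hx0 (hv w x0); case: (not_both_one s na0 h).
have Y y : row2 b k y -> n b y = 1%N.
  move=> hy; have [_ s] := row2_third t3 hw0; have e := W _ hw0.
  by have [[_ h]|[_ //]] := mid_row t2 hy hw0 (hv y w0); case: (not_both_one s e h).
have X x : row2 a b x -> n a x = 1%N.
  move=> hx; have [_ s] := row2_third t2 hy0; have e := Y _ hy0.
  by have [[_ h]|[_ //]] := mid_row t hx hy0 (hv x y0); case: (not_both_one s e h).
have step i j h u0 : tri i j h -> (forall u, row2 j h u -> n j u = 1%N) -> row2 j h u0 ->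
    (#|[set u | row2 i j u]| < #|[set u | row2 j h u]|)%N.
  move=> tt one hu0.
  rewrite (cardsD1 u0 [set u | row2 j h u]) inE hu0 add1n ltnS.
  have inj : injective (fun u => halve (u + u0)) by move=> u v /(halve_inj hodd)/addIr.
  rewrite -(card_imset (mem [set u | row2 i j u]) inj); apply: subset_leq_card.
  apply/subsetP => _ /imsetP[u hu ->]; rewrite inE in hu; rewrite !inE; apply/andP; split.
    apply/eqP => e; have eu : u = u0.
      by move/(congr1 (fun w => w *+ 2)): e; rewrite (halveK hodd) mulr2n => /addIr.
    have [h0 _] := row2_third tt hu; by move: hu0; rewrite -eu /row2 h0 andbF.
  have [[_ e]|[//]] := mid_row tt hu hu0 (hv u u0).
  by have [_ s] := row2_third (triR tt) hu0; case: (not_both_one s (one _ hu0) e).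
have s1 := step a b k y0 t Y hy0.
have s2 := step b k a w0 t2 W hw0.
have s3 := step k a b x0 t3 X hx0.
by have := ltn_trans (ltn_trans s1 s2) s3; rewrite ltnn.
Qed.

Lemma three_types a b k x0 y0 w0 : tri a b k ->
  row2 a b x0 -> row2 b k y0 -> row2 k a w0 -> False.
Proof.
move=> t hx0 hy0 hw0.
have e : x0 + y0 = halve (x0 + y0) *+ 2 by rewrite (halveK hodd).
have [[_ h]|[_ h]] := mid_row t hx0 hy0 e; last exact: three_types_cyclic t hx0 hy0 hw0 h.
by apply: (three_types_cyclic (triC (triR t)) _ _ _ h (w0 := w0) (y0 := x0)); rewrite row2C.
Qed.

(** * Monochromatic rows and the case of a missing pair of colors *)

Definition mono_set i : {set G} := [set x | n i x == p].

Lemma full_sliceP i x : (forall t, t \in K -> c (x + t) = i) -> n i x = p.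
Proof. by move=> h; apply: eq_card => t; apply/sliceP/idP => [[]//|tK]; split=> //; apply: h. Qed.

Lemma mono_reflect i j h s y : tri i j h -> n i s = p -> row2 j h y -> n i (y *+ 2 - s) = p.
Proof.
move=> t ns /andP[/slice_gt0[u uK cu] /slice_gt0[v vK cv]]; apply: full_sliceP => w wK.
have [ij jh ih] := tri_neq t.
have eqv r : s + (r *+ 2 - w) + (y *+ 2 - s + w) = (y + r) *+ 2 by zmod.
have cs r : r \in K -> c (s + (r *+ 2 - w)) = i.
  by move=> rK; apply: full_slice ns _; apply: grpB => //; apply: grpMn.
have [//|h1] := end_color rf t (eqv u) (cs u uK) cu.
have [//|h2] := end_color rf (triR (triC t)) (eqv v) (cs v vK) cv.
by case: jh; rewrite -h1.
Qed.

Lemma stab_row2 i j h y y' : tri i j h -> row2 j h y -> row2 j h y' ->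
  y - y' \in tstab_group (mono_set i).
Proof.
move=> t hy hy'; rewrite -(grp_dbl hodd); apply/tstabP => s; rewrite inE => /eqP hs.
apply: (mem_eq (x := y *+ 2 - (y' *+ 2 - s))); last by zmod.
by rewrite inE; apply/eqP; apply: (mono_reflect t) hy; apply: (mono_reflect t).
Qed.

Lemma K_sub_stab i t : t \in K -> t \in tstab_group (mono_set i).
Proof. by move=> tK; apply/tstabP => s; rewrite !inE slice_shift. Qed.

Lemma stab_proper i s y : n i s = p -> c y <> i -> ~ forall x, x \in tstab_group (mono_set i).
Proof.
move=> hs cy /(_ (y - s))/tstabP/(_ s); rewrite !inE hs eqxx addrC subrK => /(_ isT)/eqP e.
by apply: cy; rewrite -[y]addr0; apply: full_slice e (grp0 K).
Qed.

Section MissingPair.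
Variables a b k : 'I_3.
Hypotheses (tabk : tri a b k) (noak : forall x, ~~ row2 a k x).

Lemma row_of_a x : (0 < n a x)%N -> n a x = p \/ row2 a b x.
Proof.
move=> xa; have sx := slice_sum x tabk; have := noak x; rewrite /row2 xa /= -eqn0Ngt => /eqP xk.
by case: (posnP (n b x)) => xb; [left; rewrite -sx xb xk !addn0 | right].
Qed.

Lemma row_ab_exists : exists x, row2 a b x.
Proof.
case: (boolP [exists x, row2 a b x]) => [/existsP//|]; rewrite negb_exists => /forallP h.
exfalso; apply: (@class_not_periodic K a K_nontrivial) => x t tK cx.
have := color_slice_gt0 x; rewrite cx => /row_of_a[e|]; last by rewrite (negbTE (h x)).
exact: full_slice.
Qed.

(** All rows with colors [b] and [k] are assumed to lie in [x0 + T]. So every [T]-coset is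
    monochromatic or meets both [a] and [b], and [no_monochromatic_coset] applies to [T] in place of
    [K]. *)
Lemma mono_coset_contra s x0 : n k s = p -> row2 a b x0 ->
  (forall y, row2 b k y -> y - x0 \in tstab_group (mono_set k)) -> False.
Proof.
move=> hs hx0 hBC; have [ab bk ak] := tri_neq tabk.
pose T := tstab_group (mono_set k).
have t : tri k a b := triR (triR tabk).
have full x u : n k x = p -> u \in T -> c (x + u) = k.
  move=> hx /tstabP/(_ x); rewrite !inE hx eqxx => /(_ isT)/eqP e.
  by rewrite -[x + u]addr0; apply: full_slice e (grp0 K).
apply: (no_monochromatic_coset (K := T) t); last 2 first.
- by exists s => u; apply: full.
- case/andP: hx0 => /slice_gt0[u uK cu] /slice_gt0[v vK cv].
  by exists x0; split; [exists u | exists v] => //; apply: K_sub_stab.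
move=> x; have [hx|/eqP hx] := boolP (n k x == p).
  left=> u uT; rewrite (full x) ?(eqP hx) // -[x]addr0.
  by rewrite (full_slice (eqP hx) (grp0 K)).
have [hx'|hx'] := boolP (x - x0 \in T).
  right; case/andP: hx0 => /slice_gt0[u /(K_sub_stab k) uT cu] /slice_gt0[v /(K_sub_stab k) vT cv].
  split; [exists (x0 + u - x) | exists (x0 + v - x)]; try by rewrite addrC subrK.
    by apply: mem_eq (grpB uT hx') _; zmod.
  by apply: mem_eq (grpB vT hx') _; zmod.
have notk u : u \in T -> c (x + u) <> k.
  move=> uT cu; have pk := color_slice_gt0 (x + u); rewrite cu in pk.
  case: (posnP (n b (x + u))) => pb; last first.
    have : x + u - x0 \in T by apply: hBC; rewrite /row2 pb.
    by rewrite addrAC (grpDr _ uT) (negbTE hx').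
  have := noak (x + u); rewrite /row2 pk andbT -eqn0Ngt => /eqP pa.
  have e : n k (x + u) = p by rewrite -(slice_sum (x + u) tabk) pa pb.
  apply: hx; apply: full_sliceP => v vK.
  have := full (x + u) (v - u) e; rewrite addrA addrAC addrK => ->//.
  by apply: grpB => //; apply: K_sub_stab.
case: (boolP [exists u, (u \in T) && (c (x + u) != c x)]) => [/existsP[u /andP[uT /eqP ne]]|].
  have x00 : c (x + 0) = c x by rewrite addr0.
  have nk0 := notk 0 (grp0 T); rewrite x00 in nk0; have nku := notk u uT.
  right; case: (triP tabk (c x)) => cx //; case: (triP tabk (c (x + u))) => cu //;
    rewrite ?cx ?cu in ne => //.
  - by split; [exists 0; rewrite ?grp0 ?x00 | exists u].
  - by split; [exists u | exists 0; rewrite ?grp0 ?x00].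
rewrite negb_exists => /forallP h; left=> u uT.
by have := h u; rewrite uT negbK => /eqP.
Qed.

End MissingPair.

(** All rows of type [a], [b] agree modulo [Tk], and all rows of type [k], [b] modulo [Ta]. By
    [mono_coset_contra] some row [Y] of the second type is not congruent to the first type modulo
    [Tk], and some [X] of the first is not congruent to the second modulo [Ta]. The midpoint row of
    [X] and [Y] has one of the two types and contradicts one of these choices. *)
Lemma no_mono_row a b k s : tri a b k -> (forall x, ~~ row2 a k x) -> n k s = p -> False.
Proof.
move=> t noak hs; have [ab bk ak] := tri_neq t.
have t' : tri k b a := triC (triR t).
have noak' x : ~~ row2 k a x by rewrite row2C.
have [x0 hx0] := row_ab_exists t noak; have [y0 hy0] := row_ab_exists t' noak'.
have hv (u v : G) : u + v = halve (u + v) *+ 2 by rewrite (halveK hodd).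
pose Tk := tstab_group (mono_set k); pose Ta := tstab_group (mono_set a).
have stk x : row2 a b x -> x - x0 \in Tk by move=> hx; apply: stab_row2 (triR (triR t)) hx hx0.
have sta y : row2 k b y -> y - y0 \in Ta by move=> hy; apply: stab_row2 (triR (triC t)) hy hy0.
have [r /eqP hr|none] := pickP (fun r => n a r == p); last first.
  have [y cy] := hne a; apply: (stab_proper hs (y := y)); first by rewrite cy.
  apply: (@class_not_in_coset a Tk x0) => x cx; apply: stk.
  have := color_slice_gt0 x; rewrite cx => /(row_of_a t noak)[/eqP|//].
  by rewrite none.
case: (boolP [forall y, row2 b k y ==> (y - x0 \in Tk)]) => [/forallP h|].
  by apply: (mono_coset_contra t noak hs hx0) => y hy; have /implyP := h y; apply.
rewrite negb_forall => /existsP[Y]; rewrite negb_imply => /andP[hY nY].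
case: (boolP [forall x, row2 b a x ==> (x - y0 \in Ta)]) => [/forallP h|].
  by apply: (mono_coset_contra t' noak' hr hy0) => x hx; have /implyP := h x; apply.
rewrite negb_forall => /existsP[X]; rewrite negb_imply => /andP[hX nX].
rewrite row2C in hX.
have e := hv X Y; have [[hz _]|[hz _]] := mid_row t hX hY e.
- case/negP: nY; apply: mem_eq (grpB (grpMn 2 (stk _ hz)) (stk _ hX)) _.
  by apply: zmod_eq1 (esym e) _; zmod.
- rewrite row2C in hz; rewrite row2C in hY.
  case/negP: nX; apply: mem_eq (grpB (grpMn 2 (sta _ hz)) (sta _ hY)) _.
  by apply: zmod_eq1 (esym e) _; zmod.
Qed.

(** Points of color [k] in rows with several [k] are preserved by midpoints with the class [a]: as
    the row of the latter has a single [a], [slice_bound] gives the midpoint row at least as many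
    [k]. Spanning would color everything [k]. *)
Lemma all_single a b k : tri a b k -> (forall x, ~~ row2 a k x) ->
  (forall x, row2 a b x -> n a x = 1%N) -> forall y, row2 b k y -> n k y = 1%N.
Proof.
move=> t noak one y hy; apply/eqP; apply: contraT => ny; exfalso.
have [ab bk ak] := tri_neq t; have t' : tri k b a := triC (triR t).
have noak' x : ~~ row2 k a x by rewrite row2C.
pose P := [set y | [&& c y == k, row2 b k y & n k y != 1%N]].
have [x cx] := hne a.
suff : x \in P by rewrite inE cx => /and3P[/eqP/ak].
apply: (spanning_midpoint hodd (sp (i := a))) => [||s z].
- case/andP: (hy) => _ /slice_gt0[u uK cu]; exists (y + u).
  by rewrite inE cu eqxx /row2 !slice_shift //; move: hy ny; rewrite /row2 => -> ->.
- by exists x; rewrite inE cx.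
rewrite !inE => /eqP cs /and3P[/eqP cz hz nz].
have hs : row2 a b s.
  have := color_slice_gt0 s; rewrite cs => /(row_of_a t noak)[e|//].
  by case: (no_mono_row t' noak' e).
have e : s + z = halve (s + z) *+ 2 by rewrite (halveK hodd).
have [[_ h]|[hm ns]] := mid_row t hs hz e; first by rewrite h in nz.
set m := halve (s + z) in e hm *; rewrite hm /=.
have na0 : n a m = 0%N.
  by have := noak m; rewrite /row2; case/andP: (hm) => _ ->; rewrite andbT -eqn0Ngt => /eqP.
apply/andP; split.
  have [cm|->//] := mid_color rf (triR (triC t)) e cs cz.
  by have := color_slice_gt0 m; rewrite cm na0.
case/andP: hs => sa _; case/andP: hz => zb zk.
have h1 := slice_bound (triR (triC t)) e sa zk.
have := slice_sum m t; have := slice_sum z t.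
move: nz h1 na0 ns zb zk; move: (n a m) (n b m) (n k m) (n a s) (n a z) (n b z) (n k z); clear; lia.
Qed.

(** Give each row its color [a] or [k] if it has one, and [b] otherwise. A rainbow progression of
    rows lifts to points, since a row colored [b] is entirely [b]. The periodic coloring must have
    its class [b], which is [U], in a coset of a proper subgroup of odd index. Equality can only
    occur if [U] is a full coset of index [3], too small an index for the cosets that [a], [k] and
    [b] need. *)
Lemma empty_rows_sparse a b k (U := [set x | (n a x == 0%N) && (n k x == 0%N)]) :
  tri a b k -> (forall x, ~~ row2 a k x) -> (3 * #|U| < #|G|)%N.
Proof.
move=> t noak; have [ab bk ak] := tri_neq t.
have G0 : (0 < #|G|)%N by apply/card_gt0P; exists 0.
have [->|/set0Pn[u0 hu0]] := eqVneq U set0; first by rewrite cards0.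
pose c1 x := if (0 < n a x)%N then a else if (0 < n k x)%N then k else b.
have c1a x : (0 < n a x)%N -> c1 x = a by rewrite /c1 => ->.
have c1k x : (0 < n k x)%N -> c1 x = k.
  by move=> h; have := noak x; rewrite /row2 h andbT /c1 h => /negbTE->.
have c1U x : (c1 x == b) = (x \in U).
  rewrite inE /c1; have [h|h] := posnP (n a x).
    by have [h'|h'] := posnP (n k x); rewrite ?eqxx // [k == b]eq_sym; apply/negP => /eqP.
  by apply/negP => /eqP.
have pt x : exists2 v, v \in K & c (x + v) = c1 x.
  rewrite /c1; case: ifP => [/slice_gt0//|/negbT]; rewrite -eqn0Ngt => /eqP xa.
  case: ifP => [/slice_gt0//|/negbT]; rewrite -eqn0Ngt => /eqP xk.
  apply/slice_gt0; have := slice_sum x t; rewrite xa xk add0n addn0 => ->; exact: prime_gt0.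
have ptb x v : c1 x = b -> v \in K -> c (x + v) = b.
  move=> /eqP; rewrite c1U inE => /andP[/eqP xa /eqP xk]; apply: full_slice.
  by rewrite -(slice_sum x t) xa xk addn0.
have rf1 : rainbow_free c1.
  move=> x y z e [n1 n2 n3].
  have [u uK cu] := pt x; have [v vK cv] := pt y; have [w wK cw] := pt z.
  have fin u' v' w' : u' + v' = w' *+ 2 -> c (x + u') = c1 x -> c (y + v') = c1 y ->
      c (z + w') = c1 z -> False.
    move=> e' h1 h2 h3; apply: (rf (x := x + u') (y := y + v') (z := z + w')).
      by rewrite /is_3ap; apply: zmod_eq2 e e' _; zmod.
    by rewrite /rainbow h1 h2 h3.
  have [ez|ez] := eqVneq (c1 z) b.
    apply: (fin u v (halve (u + v))) => //; first by rewrite (halveK hodd).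
    by rewrite ez; apply: ptb; rewrite // (grp_halve hodd); apply: grpD.
  have [ey|ey] := eqVneq (c1 y) b.
    apply: (fin u (w *+ 2 - u) w) => //; first by zmod.
    by rewrite ey; apply: ptb; rewrite // grpB // grpMn.
  have [ex|ex] := eqVneq (c1 x) b.
    apply: (fin (w *+ 2 - v) v w) => //; first by zmod.
    by rewrite ex; apply: ptb; rewrite // grpB // grpMn.
  move/eqP: ex; move/eqP: ey; move/eqP: ez.
  by case: (triP t (c1 x)) n1 n2 n3 => -> //; case: (triP t (c1 y)) => -> //;
    case: (triP t (c1 z)) => -> //.
have per1 x v : v \in K -> c1 (x + v) = c1 x by move=> vK; rewrite /c1 !slice_shift.
have c1c x : c x <> b -> c1 x = c x.
  by have := color_slice_gt0 x; case: (triP t (c x)) => -> // h _; [apply: c1a | apply: c1k].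
have surj1 i : exists x, c1 x = i.
  have [x cx] := hne i; case: (i =P b) => [->|ib]; last by exists x; rewrite c1c cx.
  by exists u0; apply/eqP; rewrite c1U.
have [i [H [g [pH hH]]]] := periodic_case K_nontrivial rf1 surj1 per1.
have [ei|/eqP ib] := eqVneq i b; last first.
  exfalso; apply: (proper_not_spanning (sp (i := i)) pH (g := g)) => x.
  by rewrite inE => /eqP cx; apply: hH; rewrite c1c cx.
have UH x : x \in U -> x - g \in H by rewrite -c1U -ei => /eqP; apply: hH.
have cH : (3 * #|H| <= #|G|)%N.
  have L := Lagrange (subsetT H); rewrite cardsT in L.
  have oI : odd #|[set: G] : H|%g by move: hodd; rewrite -L oddM => /andP[].
  have ltH : (#|H| < #|G|)%N by rewrite -cardsT; apply: proper_card.
  move: oI L ltH; case: #|[set: G] : H|%g => [|[|[|m]]] // _ <-; first by rewrite muln1 ltnn.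
  by rewrite [(_ * m.+3)%N]mulnC => _; rewrite leq_mul2r orbT.
have injg : injective (fun x : G => x - g) by apply: addIr.
have cU : (#|U| <= #|H|)%N.
  rewrite -(card_imset (mem U) injg); apply: subset_leq_card.
  by apply/subsetP => _ /imsetP[x xU ->]; apply: UH.
rewrite ltnNge; apply/negP => big.
have [eUH eGH] : #|U| = #|H| /\ #|G| = (3 * #|H|)%N.
  move: cH cU big; move: #|U| #|H| #|G|; clear; lia.
have HU h : h \in H -> h + g \in U.
  have -> : (h \in H) = (h \in [set x - g | x in U]).
    apply/esym; apply: (subset_cardP _ _ h); first by rewrite (card_imset (mem U) injg).
    by apply/subsetP => _ /imsetP[x xU ->]; apply: UH.
  by case/imsetP => x xU ->; rewrite subrK.
(* [U] is the full coset [g + H], so every point of the coset opposite to [w] is the reflection of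
   [w] in a point of color [b]. *)
have refl1 i' w h : tri i' b (if i' == a then k else a) -> c1 w = i' -> w - g \notin H -> h \in H ->
    c1 (g *+ 2 - w + h) = i'.
  move=> ti cw hw hh; have hu := HU (halve h); rewrite (grp_halve hodd) hh in hu.
  have e : w + (g *+ 2 - w + h) = (halve h + g) *+ 2.
    by rewrite mulrnDl (halveK hodd); zmod.
  have cu : c1 (halve h + g) = b by apply/eqP; rewrite c1U hu.
  have [//|/eqP] := end_color rf1 ti e cw cu; rewrite c1U => /UH hb.
  case/negP: hw; rewrite -grpN; apply: mem_eq (grpB hb hh) _; zmod.
have cos i' w : tri i' b (if i' == a then k else a) -> c w = i' -> w - g \notin H /\
    (forall h, h \in H -> c1 (w + h) = i') /\ forall h, h \in H -> c1 (g *+ 2 - w + h) = i'.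
  move=> ti cw; have [n1 _ _] := tri_neq ti.
  have cw1 : c1 w = i' by rewrite c1c cw.
  have hw : w - g \notin H.
    by apply/negP => /HU; rewrite subrK -c1U cw1 => /eqP.
  split=> //; split=> h hh; last exact: refl1.
  have hw' : g *+ 2 - w - g \notin H.
    by rewrite -grpN (_ : - _ = w - g) //; zmod.
  have cw' : c1 (g *+ 2 - w) = i'.
    by rewrite -[g *+ 2 - w]addr0; apply: (refl1 i' w 0 ti cw1 hw (grp0 H)).
  have := refl1 i' (g *+ 2 - w) h ti cw' hw' hh.
  by have -> : g *+ 2 - (g *+ 2 - w) + h = w + h by zmod.
have ta : tri a b (if a == a then k else a) by rewrite eqxx.
have tk : tri k b (if k == a then k else a) by rewrite eq_sym (introF eqP ak); apply: triC (triR t).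
have [x cx] := hne a; have [y cy] := hne k.
have [hx [xH xH']] := cos a x ta cx; have [hy [yH _]] := cos k y tk cy.
pose C w := [set w + h | h in H].
have CC w : #|C w| = #|H| by rewrite (card_imset (mem H) (addrI w)).
have dis (P Q : {set G}) : (forall w, w \in P -> w \in Q -> False) -> P :&: Q = set0.
  by move=> h; apply/setP => w; rewrite in_set0; apply/setIP => -[]; apply: h.
have gH w : w \in C g -> c1 w = b.
  by case/imsetP => h hh ->; apply/eqP; rewrite c1U addrC; apply: HU.
have inC w i' : (forall h, h \in H -> c1 (w + h) = i') -> forall v, v \in C w -> c1 v = i'.
  by move=> h v /imsetP[u uH ->]; apply: h.
have d1 : C x :&: C (g *+ 2 - x) = set0.
  apply: dis => w /imsetP[h hh ->] /imsetP[h' hh' e]; case/negP: hx; rewrite -(grp_dbl hodd).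
  by apply: mem_eq (grpB hh' hh) _; apply: zmod_eq1 (esym e) _; zmod.
have d2 : C x :&: C y = set0.
  by apply: dis => w /(inC _ _ xH) e /(inC _ _ yH); rewrite e.
have d3 : C (g *+ 2 - x) :&: C y = set0.
  by apply: dis => w /(inC _ _ xH') e /(inC _ _ yH); rewrite e.
have d4 : C x :&: C g = set0 by apply: dis => w /(inC _ _ xH) e /gH; rewrite e.
have d5 : C (g *+ 2 - x) :&: C g = set0 by apply: dis => w /(inC _ _ xH') e /gH; rewrite e.
have d6 : C y :&: C g = set0 by apply: dis => w /(inC _ _ yH) e /gH; rewrite e => /esym.
(* Four disjoint cosets of a subgroup of index [3]: two in color [a], one in [k], one in [b]. *)
have := max_card (mem (C x :|: C (g *+ 2 - x) :|: C y :|: C g)).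
rewrite !cardsU !setIUl d1 d2 d3 d4 d5 d6 !setU0 !cards0 !subn0 !CC eGH.
by have := cardG_gt0 H; move: #|H|; clear; lia.
Qed.

Lemma missing_pair_false a b k : tri a b k -> (forall x, ~~ row2 a k x) -> False.
Proof.
move=> t noak; have [ab bk ak] := tri_neq t; have t' : tri k b a := triC (triR t).
have noak' x : ~~ row2 k a x by rewrite row2C.
(* If a row [X] has several [a], [mid_row] with [X] leaves a single [k] in each row of the other
   type, and [all_single] read backwards contradicts the choice of [X]. *)
have [A1 C1] : (forall x, row2 a b x -> n a x = 1%N) /\ (forall y, row2 k b y -> n k y = 1%N).
  case: (boolP [forall x, row2 a b x ==> (n a x == 1%N)]) => [/forallP h|].
    have h' x : row2 a b x -> n a x = 1%N by move=> hx; apply/eqP; have /implyP := h x; apply.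
    by split=> // y; rewrite row2C; apply: all_single h' y.
  rewrite negb_forall => /existsP[X]; rewrite negb_imply => /andP[hX /eqP nX].
  have h' y : row2 k b y -> n k y = 1%N.
    rewrite row2C => hy; have e : X + y = halve (X + y) *+ 2 by rewrite (halveK hodd).
    by have [[_ //]|[_ /nX]] := mid_row t hX hy e.
  by split=> // x; rewrite row2C; apply: (all_single t' noak' h').
have na1 x : c x = a -> n a x = 1%N.
  move=> cx; have := color_slice_gt0 x; rewrite cx => /(row_of_a t noak)[/(no_mono_row t' noak')//|].
  exact: A1.
have nk1 x : c x = k -> n k x = 1%N.
  move=> cx; have := color_slice_gt0 x; rewrite cx => /(row_of_a t' noak')[/(no_mono_row t noak)//|].
  exact: C1.
pose A := color_class c a; pose C := color_class c k.
have QP x : reflect (c x = a \/ c x = k) (x \in A :|: C).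
  by rewrite !inE; apply: (iffP orP) => -[/eqP ->|/eqP ->]; rewrite ?eqxx; by [left|right].
have cA x : x \in A -> c x = a by rewrite inE => /eqP.
have cC x : x \in C -> c x = k by rewrite inE => /eqP.
have uniq_row i q q' : n i q' = 1%N -> c q = i -> c q' = i -> q - q' \in K -> q = q'.
  move=> nq cq cq' hq; have /card_le1_eqP h : (n i q' <= 1)%N by rewrite nq.
  have h0 : 0 \in slice i q' by apply/sliceP; rewrite grp0 addr0.
  have h1 : q - q' \in slice i q' by apply/sliceP; split; rewrite // [q' + _]addrC subrK.
  by apply/eqP; rewrite -subr_eq0; apply/eqP; apply: h.
have mixed q q' : c q = a -> c q' = k -> q - q' \in K -> False.
  move=> cq cq' hq; have /negP := noak q; apply; apply/andP; split; apply/slice_gt0.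
    by exists 0; rewrite ?grp0 ?addr0.
  by exists (q' - q); [rewrite -grpN opprB | rewrite addrC subrK].
have mc : mixed_closed K A C.
  split=> [x y /cA cx /cC cy|x y /cA cx /cC cy|x y /cA cx /cC cy|q q'].
  - have e : x + y = halve (x + y) *+ 2 by rewrite (halveK hodd).
    by apply/QP; apply: mid_color (triR (triC t)) e cx cy.
  - have e : y + (x *+ 2 - y) = x *+ 2 by zmod.
    by apply/QP; have [|] := end_color rf (triR (triR t)) e cy cx; [right | left].
  - have e : x + (y *+ 2 - x) = y *+ 2 by zmod.
    by apply/QP; apply: end_color (triR (triC t)) e cx cy.
  move=> /QP[cq|cq] /QP[cq'|cq'] hq.
  - exact: (uniq_row a q q' (na1 _ cq') cq cq' hq).
  - by case: (mixed q q').
  - by case: (mixed q' q) => //; rewrite -grpN opprB.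
  - exact: (uniq_row k q q' (nk1 _ cq') cq cq' hq).
have A0 : A != set0 by have [x cx] := hne a; apply/set0Pn; exists x; rewrite inE cx.
have C0 : C != set0 by have [x cx] := hne k; apply/set0Pn; exists x; rewrite inE cx.
apply: (mixed_dense hodd K_nontrivial mc (sp (i := a)) (sp (i := k)) A0 C0).
apply: leq_ltn_trans (empty_rows_sparse t noak); rewrite leq_mul2l /=.
apply: subset_leq_card; apply/subsetP => x; rewrite !inE => /forall_inP h.
apply/andP; split; rewrite -leqn0 leqNgt; apply/negP => /slice_gt0[u uK cu].
  have /h : x + u \in A :|: C by apply/QP; left.
  by rewrite opprD addNKr grpN uK.
have /h : x + u \in A :|: C by apply/QP; right.
by rewrite opprD addNKr grpN uK.
Qed.

Lemma prime_rows_false : False.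
Proof.
have [b [k t]] := tri_complete ord0; set a := ord0 in t.
case: (boolP [exists x, row2 a b x]) => [/existsP[x hx]|]; last first.
  rewrite negb_exists => /forallP h; exact: (missing_pair_false (triR (triC t))).
case: (boolP [exists x, row2 b k x]) => [/existsP[y hy]|]; last first.
  rewrite negb_exists => /forallP h; exact: (missing_pair_false (triC t)).
case: (boolP [exists x, row2 k a x]) => [/existsP[w hw]|]; last first.
  rewrite negb_exists => /forallP h; by apply: (missing_pair_false t) => u; rewrite row2C.
exact: three_types t hx hy hw.
Qed.

End PrimeRows.
End MinimalCounterexample.

(** * The structure theorem *)

Theorem rainbow_free_class_in_proper_coset (G : finZmodType) (c : G -> 'I_3) :
  odd #|G| -> rainbow_free c -> (forall i, exists x, c x = i) -> class_in_proper_coset c.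
Proof.
have [m] := ubnP #|G|; elim: m => // m IH in G c * => leGm hodd rf hne.
case: (boolP [exists i, exists H : {group G}, exists g,
    (H \proper [set: G]) && [forall x, (c x == i) ==> (x - g \in H)]]).
  case/existsP => i /existsP[H /existsP[g /andP[pH /forallP h]]]; exists i, H, g; split=> // x cx.
  by have /implyP := h x; apply; apply/eqP.
rewrite negb_exists => /forallP no; exfalso.
have sp i : spanning (color_class c i).
  move=> H g hH x; apply: contraT => hx; exfalso.
  have := no i; rewrite negb_exists => /forallP/(_ H); rewrite negb_exists => /forallP/(_ g)/negP.
  apply; apply/andP; split; first by apply/properP; split; [apply: subsetT | exists x].
  by apply/forallP => y; apply/implyP => cy; apply: hH; rewrite inE.
have G1 : (1 < #|G|)%N.
  have [b [k /tri_neq[n1 _ _]]] := tri_complete ord0.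
  have [x cx] := hne ord0; have [y cy] := hne b.
  rewrite -cardsT; apply: leq_trans (subset_leq_card (subsetT [set x; y])).
  by rewrite cards2 (_ : x != y) //; apply/eqP => e; case: n1; rewrite -cx -cy e.
(* Any prime divisor of the order would do; [K] is generated by an element of that order. *)
have [x xG ox] : {x | x \in [set: G]%G & #[x]%g = pdiv #|G|}.
  by apply: Cauchy; [apply: pdiv_prime | rewrite /= cardsT; apply: pdiv_dvd].
apply: (prime_rows_false hodd rf hne sp _ (K := <[x]>%G)); last first.
  by rewrite -orderE ox; apply: pdiv_prime.
move=> K d K1 rfd hned per; apply: class_in_proper_coset_periodic K1 _ rfd hned per => //.
by move=> Q d' oQ ltQ; apply: IH => //; apply: leq_trans ltQ _.
Qed.

Section Structure.
Variables (G : finZmodType) (c : G -> 'I_3).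
Hypothesis hodd : odd #|G|.

Lemma translate_rainbow_free g : rainbow_free c -> rainbow_free (translate_coloring c g).
Proof. by move=> rf x y z e; apply: rf; rewrite /is_3ap; apply: zmod_eq1 e _; zmod. Qed.

(* Reflections in the points of class i generate the translations by H. *)
Lemma outside_class_structure i j k (H : {group G}) : tri i j k -> rainbow_free c -> c 0 = i ->
  H = <<color_class c i>>%G -> let L := color_class c j :\: H in
  periodic H L /\ (L = oppset L /\ oppset L = dblset L).
Proof.
move=> t rf c0 eH L; have [ij jk ik] := tri_neq t.
have iH x : c x = i -> x \in H by move=> cx; rewrite eH mem_gen // inE cx.
have LP x : reflect (c x = j /\ x \notin H) (x \in L).
  by rewrite !inE; apply: (iffP andP) => -[h1 h2]; split=> //; apply/eqP.
have refl s x : c s = i -> x \in L -> s *+ 2 - x \in L.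
  move=> cs /LP[cx xH].
  have nH : s *+ 2 - x \notin H by rewrite grpDl ?grpN // grpMn // iH.
  have e : x + (s *+ 2 - x) = s *+ 2 by zmod.
  apply/LP; split=> //; have [//|/iH] := end_color rf (triC t) e cx cs.
  by rewrite (negbTE nH).
have HT h : h \in H -> h \in tstab L.
  apply/subsetP; rewrite eH gen_subG; apply/subsetP => s; rewrite inE => /eqP cs.
  rewrite -(grp_dbl hodd (tstab_group L)); apply/tstabP => x xL.
  by apply: mem_eq (refl s _ cs (refl 0 x c0 xL)) _; zmod.
have oppL x : x \in L -> - x \in L.
  by move=> xL; apply: mem_eq (refl 0 x c0 xL) _; zmod.
have dblL x : x \in L -> x *+ 2 \in L.
  move=> /LP[cx xH]; have nH : x *+ 2 \notin H by rewrite (grp_dbl hodd).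
  have e : 0 + x *+ 2 = x *+ 2 by zmod.
  apply/LP; split=> //; have [/iH|//] := end_color rf t e c0 cx.
  by rewrite (negbTE nH).
have eO : oppset L = L.
  apply/setP => x; apply/imsetP/idP => [[y yL ->]|xL]; first exact: oppL.
  by exists (- x); rewrite ?opprK ?oppL.
have eD : dblset L = L.
  apply/eqP; rewrite eqEcard (card_imset (mem L) (dbl_inj hodd)) leqnn andbT.
  by apply/subsetP => _ /imsetP[x xL ->]; apply: dblL.
split; last by rewrite eO eD.
apply/setP => x; apply/imset2P/idP => [[y h yL hH ->]|xL].
  by have /tstabP := HT h hH; apply.
by exists x 0; rewrite ?grp0 ?addr0.
Qed.

(** By halving, two points of a progression in [H] bring the third into [H]. A rainbow progression
    therefore has its point of color [i] in [H] and the other two outside. *)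
Lemma structure_rainbow_free i j k (H : {group G}) : tri i j k ->
  (forall x, c x = i -> x \in H) -> rainbow_free_on H c ->
  (forall l, l = j \/ l = k -> let L := color_class c l :\: H in
     periodic H L /\ (L = oppset L /\ oppset L = dblset L)) -> rainbow_free c.
Proof.
move=> t iH rfH hL x y z e; have [ij jk ik] := tri_neq t.
pose out l x := c x = l /\ x \notin H.
have LP l u : reflect (out l u) (u \in color_class c l :\: H).
  by rewrite !inE; apply: (iffP andP) => -[h1 h2]; split=> //; apply/eqP.
have addH l u h : l = j \/ l = k -> out l u -> h \in H -> out l (u + h).
  move=> hl /LP ul hH; have [p _] := hL l hl; apply/LP; rewrite -p.
  by apply/imset2P; exists u h.
have oppH l u : l = j \/ l = k -> out l u -> out l (- u).
  move=> hl /LP ul; have [_ [p _]] := hL l hl; apply/LP; rewrite p.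
  by apply/imsetP; exists u.
have dblH l u : l = j \/ l = k -> out l u -> out l (u *+ 2).
  move=> hl /LP ul; have [_ [p q]] := hL l hl; apply/LP; rewrite p q.
  by apply/imsetP; exists u.
(* In each position of [s] the relation would equate a point of the outer part of [l] with one of
   [l'], as both parts are stable under [H], negation and doubling. *)
have final l l' u v s : l = j \/ l = k -> l' = j \/ l' = k -> l <> l' ->
    c s = i -> c u = l -> c v = l' -> u \notin H -> v \notin H ->
    [/\ s + u <> v *+ 2, s + v <> u *+ 2 & u + v <> s *+ 2].
  move=> hl hl' ne cs cu cv uH vH; have sH := iH s cs.
  have ou : out l u by []. have ov : out l' v by [].
  have no w w' : out l w -> out l' w' -> w <> w' by move=> [h1 _] [h2 _] ew; case: ne; rewrite -h1 -h2 ew.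
  split.
  - by rewrite addrC; apply: no; [apply: addH | apply: dblH].
  - by rewrite addrC => /esym; apply: no; [apply: dblH | apply: addH].
  - move=> e'; apply: (no (- u + s *+ 2) v) => //; first by apply: addH; [|apply: oppH|apply: grpMn].
    by rewrite -e' addKr.
rewrite /rainbow => -[n1 n2 n3].
have rb : rainbow c x y z by split.
have zxy : z *+ 2 - x = y by rewrite -e addrC addKr.
have zyx : z *+ 2 - y = x by rewrite -e addrK.
have xyH : x \in H -> y \in H -> False.
  by move=> hx hy; apply: (rfH x y z) => //; rewrite -(grp_dbl hodd) -e grpD.
have xzH : x \in H -> z \in H -> False.
  by move=> hx hz; apply: (xyH hx); rewrite -zxy; apply: grpB => //; apply: grpMn.
have yzH : y \in H -> z \in H -> False.
  by move=> hy hz; apply: (xyH _ hy); rewrite -zyx; apply: grpB => //; apply: grpMn.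
have two l : l <> i -> l = j \/ l = k by case: (triP t l) => ->; by [left|right|].
have [ex|nx] := eqVneq (c x) i.
  have hx := iH x ex.
  have [] := final (c y) (c z) y z x; rewrite ?ex //; try by apply: two; rewrite -ex; apply: nesym.
  - by apply/negP => /xyH; apply.
  - by apply/negP => /xzH; apply.
have [ey|ny] := eqVneq (c y) i.
  have hy := iH y ey.
  have [] := final (c x) (c z) x z y; rewrite ?ey //; try by apply: two; rewrite -ey // ; apply: nesym.
  - by apply/negP => hx; apply: xyH hx hy.
  - by apply/negP => hz; apply: yzH hy hz.
  - by rewrite addrC.
have [ez|nz] := eqVneq (c z) i.
  have hz := iH z ez.
  have [] := final (c x) (c y) x y z; rewrite ?ez //; try by apply: two; rewrite -ez.
  - by apply/negP => hx; apply: xzH hx hz.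
  - by apply/negP => hy; apply: yzH hy hz.
move/eqP: nx; move/eqP: ny; move/eqP: nz.
by case: (triP t (c x)) n1 n2 n3 => -> //; case: (triP t (c y)) => -> //;
  case: (triP t (c z)) => -> //.
Qed.

End Structure.

Theorem theorem3 (G : finZmodType) (hodd : odd #|G|) (c : G -> 'I_3)
    (hne : forall i : 'I_3, color_class c i != set0) :
  rainbow_free c <->
  exists (g : G) (H : {group G}) (i j k : 'I_3),
    let c' := translate_coloring c g in
    let A' := color_class c' i in
    let B' := color_class c' j in
    let C' := color_class c' k in
    let Bt := B' :\: H in
    let Ct := C' :\: H in
    [/\ H \proper [set: G] /\ uniq [:: i; j; k],
        A' \subset H /\ rainbow_free_on H c',
        periodic H Bt /\ periodic H Ct
      & (Bt = oppset Bt /\ oppset Bt = dblset Bt) /\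
        (Ct = oppset Ct /\ oppset Ct = dblset Ct)].
Proof.
have hne' i : exists x, c x = i.
  by have /set0Pn[x] := hne i; rewrite inE => /eqP; exists x.
split=> [rf|[g [H [i [j [k [[pH u] [AH rfH] [pB pC] [sB sC]]]]]]]].
- have [i [H [g [pH hH]]]] := rainbow_free_class_in_proper_coset hodd rf hne'.
  have [j [k t]] := tri_complete i; have [a0 ca0] := hne' i.
  have rf' := translate_rainbow_free (g := a0) rf.
  set c' := translate_coloring c a0 in rf'.
  have c'0 : c' 0 = i by rewrite /c' /translate_coloring add0r.
  exists a0, <<color_class c' i>>%G, i, j, k; cbv zeta; rewrite -/c'.
  have [pB sB] := outside_class_structure hodd t rf' c'0 erefl.
  have [pC sC] := outside_class_structure hodd (triR (triC t)) rf' c'0 erefl.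
  split=> //; split.
  (* The subgroup [H] just obtained only serves to show that the one generated by the translated
     class is proper. *)
  + apply: sub_proper_trans pH; rewrite gen_subG; apply/subsetP => x; rewrite inE => /eqP cx.
    by apply: mem_eq (grpB (hH _ cx) (hH _ ca0)) _; zmod.
  + by have /and3P[n1 n2 n3] := t; rewrite /= !inE negb_or n1 n2 n3.
  + exact: subset_gen.
  + by move=> x y z _ _ _; apply: rf'.
- have t : tri i j k by move: u; rewrite /= !inE negb_or /tri => /and3P[/andP[-> ->] -> _].
  set c' := translate_coloring c g in AH rfH pB pC sB sC.
  have rf' : rainbow_free c'.
    apply: (structure_rainbow_free hodd t _ rfH) => [x cx|l [->|->]] //.
    by apply: (subsetP AH); rewrite inE cx.
  move=> x y z e; have := rf' (x - g) (y - g) (z - g).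
  rewrite /rainbow /c' /translate_coloring !subrK; apply; rewrite /is_3ap.
  by apply: zmod_eq1 e _; zmod.
Qed.
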